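(* A finite simple graph $G$ is $\{P_5,\overline{P_5},C_5\}$-free if and only if at least one of the following holds: (a) $G$ is a split graph; (b) $G$ is obtained by substitution from smaller $\{P_5,\overline{P_5},C_5\}$-free graphs; (c) $G$ or $\overline{G}$ is obtained by split unification from smaller $\{P_5,\overline{P_5},C_5\}$-free graphs.
   Context: $P_5$ is the path on 5 vertices, $C_5$ the 5-cycle, $\overline{G}$ the complement of $G$. A graph is $\{P_5,\overline{P_5},C_5\}$-free if it has no induced subgraph isomorphic to any of $P_5$, $\overline{P_5}$, $C_5$. A graph is split if its vertex set can be partitioned into a clique and a stable set. Substitution: given vertex-disjoint graphs $G_0$ and $H$ and a vertex $x$ of $G_0$, the graph obtained by substituting $H$ for $x$ has vertex set $V(G_0\setminus x)\cup V(H)$, consists of the union of $G_0\setminus x$ and $H$, plus all edges between $V(H)$ and the neighbors of $x$ in $G_0$. ''$G$ is obtained by substitution from smaller graphs in a class'' means $G$ is isomorphic to such a graph where $G_0$ and $H$ both have fewer vertices than $G$ and both lie in the class. For $S\subseteq V(G)$ and $v\notin S$: $v$ is complete to $S$ if adjacent to all of $S$, anticomplete if adjacent to none, mixed on $S$ otherwise; a set is complete (anticomplete) to a disjoint set if each of its vertices is. An anticomponent of $S$ is a subset of $S$ inducing a connected component of the complement of $G[S]$. Composable pair: let $A,B,C,L,T$ be pairwise disjoint sets with $A,C$ non-empty, and $a^*,c^*$ two distinct vertices not in $A\cup B\cup C\cup L\cup T$. $G_1$ is a graph on $A\cup B\cup L\cup T\cup\{c^*\}$ such that $L$ is a (possibly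 empty) clique, $T$ is a (possibly empty) stable set, $A$ is complete to $B$ and anticomplete to $T$, some vertex of $A$ is complete to $L$, and $c^*$ is complete to $B\cup L$ and anticomplete to $A\cup T$ (other adjacencies arbitrary). $G_2$ is a graph on $B\cup C\cup L\cup T\cup\{a^*\}$ such that $G_2[B\cup L\cup T]=G_1[B\cup L\cup T]$, $T$ is anticomplete to $C$, $L$ is complete to $B\cup C$, $a^*$ is complete to $B\cup L$ and anticomplete to $C\cup T$, some vertex of $C$ is complete to $B$, and no vertex of $C$ is mixed on any anticomponent of $B$ (other adjacencies arbitrary). Its split unification is the graph on $A\cup B\cup C\cup L\cup T$ whose restriction to $A\cup B\cup L\cup T$ is $G_1\setminus c^*$, whose restriction to $B\cup C\cup L\cup T$ is $G_2\setminus a^*$, and in which $A$ is anticomplete to $C$. ''$G$ is obtained by split unification from smaller graphs in a class'' means $G$ is (isomorphic to) the split unification of a composable pair $(G_1,G_2)$ with $G_1,G_2$ in the class and each having fewer vertices than $G$. *)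

(* Defs.v *)
From mathcomp Require Import all_boot.

Set Implicit Arguments.
Unset Strict Implicit.
Unset Printing Implicit Defensive.

Record sgraph (V : finType) := SGraph {
  adj :> rel V;
  adj_sym : symmetric adj;
  adj_irr : irreflexive adj
}.

Definition graph_class := forall V : finType, sgraph V -> Prop.

Definition isomorphic (V W : finType) (G : sgraph V) (H : sgraph W) : Prop :=
  exists2 f : V -> W, bijective f & forall x y, H (f x) (f y) = G x y.

Section Operations.
Variables (V : finType) (G : sgraph V).

Definition compl_rel : rel V := fun x y => (x != y) && ~~ G x y.

Fact compl_rel_sym : symmetric compl_rel.
Proof. by move=> x y; rewrite /compl_rel eq_sym adj_sym. Qed.

Fact compl_rel_irr : irreflexive compl_rel.
Proof. by move=> x; rewrite /compl_rel eqxx. Qed.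

Definition compl : sgraph V := SGraph compl_rel_sym compl_rel_irr.

Definition induced_rel (S : {set V}) : rel {x | x \in S} :=
  fun x y => G (val x) (val y).

Fact induced_rel_sym S : symmetric (@induced_rel S).
Proof. by move=> x y; rewrite /induced_rel adj_sym. Qed.

Fact induced_rel_irr S : irreflexive (@induced_rel S).
Proof. by move=> x; rewrite /induced_rel adj_irr. Qed.

Definition induced (S : {set V}) : sgraph {x | x \in S} :=
  SGraph (@induced_rel_sym S) (@induced_rel_irr S).

Definition clique (K : {set V}) : Prop :=
  {in K &, forall x y, x != y -> G x y}.

Definition stable (S : {set V}) : Prop :=
  {in S &, forall x y, ~~ G x y}.

Definition split_graph : Prop :=
  exists2 K : {set V}, clique K & stable (~: K).

Definition complete (v : V) (S : {set V}) : Prop :=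
  {in S, forall w, G v w}.

Definition anticomplete (v : V) (S : {set V}) : Prop :=
  {in S, forall w, ~~ G v w}.

Definition mixed (v : V) (S : {set V}) : Prop :=
  ~ complete v S /\ ~ anticomplete v S.

Definition complete_set (X Y : {set V}) : Prop :=
  {in X, forall v, complete v Y}.

Definition anticomplete_set (X Y : {set V}) : Prop :=
  {in X, forall v, anticomplete v Y}.

Definition component (X : {set V}) : Prop :=
  exists x, X = [set y | connect G x y].

End Operations.

Definition anticomponent (V : finType) (G : sgraph V) (S X : {set V}) : Prop :=
  exists2 K : {set {x | x \in S}},
    component (compl (induced G S)) K & X = [set val x | x in K].

Definition P5_rel : rel 'I_5 := fun i j => (i.+1 == j) || (j.+1 == i).

Fact P5_rel_sym : symmetric P5_rel.
Proof. by move=> i j; rewrite /P5_rel orbC. Qed.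

Fact P5_rel_irr : irreflexive P5_rel.
Proof. by move=> i; rewrite /P5_rel orbb eqn_leq ltnn. Qed.

Definition P5 : sgraph 'I_5 := SGraph P5_rel_sym P5_rel_irr.

Definition C5_rel : rel 'I_5 := fun i j => (ordS i == j) || (ordS j == i).

Fact C5_rel_sym : symmetric C5_rel.
Proof. by move=> i j; rewrite /C5_rel orbC. Qed.

Fact C5_rel_irr : irreflexive C5_rel.
Proof. by case=> -[|[|[|[|[|i]]]]] lti. Qed.

Definition C5 : sgraph 'I_5 := SGraph C5_rel_sym C5_rel_irr.

Definition has_induced (V W : finType) (G : sgraph V) (H : sgraph W) : Prop :=
  exists S : {set V}, isomorphic (induced G S) H.

Definition P5_coP5_C5_free : graph_class := fun V G =>
  [/\ ~ has_induced G P5, ~ has_induced G (compl P5) & ~ has_induced G C5].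

Section Substitution.
Variables (V W : finType) (G0 : sgraph V) (x : V) (H : sgraph W).

Definition subst_rel : rel ({y : V | y != x} + W) := fun u v =>
  match u, v with
  | inl y, inl z => G0 (val y) (val z)
  | inl y, inr _ => G0 (val y) x
  | inr _, inl z => G0 x (val z)
  | inr h, inr k => H h k
  end.

Fact subst_rel_sym : symmetric subst_rel.
Proof. by move=> [y|h] [z|k] /=; rewrite adj_sym. Qed.

Fact subst_rel_irr : irreflexive subst_rel.
Proof. by move=> [y|h] /=; rewrite adj_irr. Qed.

Definition substitution : sgraph ({y : V | y != x} + W)%type :=
  SGraph subst_rel_sym subst_rel_irr.

End Substitution.

Definition from_substitution (P : graph_class) : graph_class := fun V G =>
  exists (V0 W : finType) (G0 : sgraph V0) (H : sgraph W) (x : V0),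
    [/\ #|V0| < #|V|, #|W| < #|V|, P V0 G0, P W H
      & isomorphic G (substitution G0 x H)].

(* The sets A, B, C, L, T and the vertices a (for a^* ) and c (for c^* ) live
   in an ambient finite type V.  The graphs G1 and G2 of a composable pair are
   presented by graphs E1 and E2 on V: they are the subgraphs of E1 and E2
   induced by pair_V1 and pair_V2, and edges of E1 (E2) outside pair_V1
   (pair_V2) play no role. *)
Section SplitUnification.
Variables (V : finType) (A B C L T : {set V}) (a c : V) (E1 E2 : sgraph V).

Definition pair_V1 : {set V} := c |: (A :|: B :|: L :|: T).
Definition pair_V2 : {set V} := a |: (B :|: C :|: L :|: T).
Definition pair_V : {set V} := A :|: B :|: C :|: L :|: T.

Definition pair_G1 : sgraph {x | x \in pair_V1} := induced E1 pair_V1.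
Definition pair_G2 : sgraph {x | x \in pair_V2} := induced E2 pair_V2.

Record composable_pair : Prop := ComposablePair {
  cp_disjoint :
    pairwise (fun X Y : {set V} => [disjoint X & Y]) [:: A; B; C; L; T];
  cp_A : A != set0;
  cp_C : C != set0;
  cp_a : a \notin pair_V;
  cp_c : c \notin pair_V;
  cp_ac : a != c;
  cp1_L : clique E1 L;
  cp1_T : stable E1 T;
  cp1_AB : complete_set E1 A B;
  cp1_AT : anticomplete_set E1 A T;
  cp1_AL : exists2 v, v \in A & complete E1 v L;
  cp1_c : complete E1 c (B :|: L);
  cp1_c_anti : anticomplete E1 c (A :|: T);
  cp2_agree : {in B :|: L :|: T &, forall x y, E2 x y = E1 x y};
  cp2_TC : anticomplete_set E2 T C;
  cp2_LBC : complete_set E2 L (B :|: C);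
  cp2_a : complete E2 a (B :|: L);
  cp2_a_anti : anticomplete E2 a (C :|: T);
  cp2_CB : exists2 v, v \in C & complete E2 v B;
  cp2_mixed : forall v X, v \in C -> anticomponent E2 B X -> ~ mixed E2 v X
}.

Definition unif_rel : rel V := fun x y =>
  [&& x \in A :|: B :|: L :|: T, y \in A :|: B :|: L :|: T & E1 x y] ||
  [&& x \in B :|: C :|: L :|: T, y \in B :|: C :|: L :|: T & E2 x y].

Fact unif_rel_sym : symmetric unif_rel.
Proof.
by move=> x y; rewrite /unif_rel (adj_sym E1) (adj_sym E2) !andbA;
  congr (_ && _ || _ && _); rewrite andbC.
Qed.

Fact unif_rel_irr : irreflexive unif_rel.
Proof. by move=> x; rewrite /unif_rel !adj_irr !andbF. Qed.

(* In a composable pair E1 and E2 agree on B, L and T, so unif_rel restricts to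
   E1 on A, B, L, T and to E2 on B, C, L, T, with no edge between A and C. *)
Definition split_unification : sgraph {x | x \in pair_V} :=
  induced (SGraph unif_rel_sym unif_rel_irr) pair_V.

End SplitUnification.

Definition from_split_unification (P : graph_class) : graph_class := fun V G =>
  exists (W : finType) (A B C L T : {set W}) (a c : W) (E1 E2 : sgraph W),
    composable_pair A B C L T a c E1 E2 /\
    [/\ #|pair_V1 A B L T c| < #|V|, #|pair_V2 B C L T a| < #|V|,
        P _ (pair_G1 A B L T c E1), P _ (pair_G2 B C L T a E2)
      & isomorphic G (split_unification A B C L T E1 E2)].

(* Main.v *)
(* A graph G in the class that is not split contains, up to complementation, two
   disjoint edges with no edge between them (Foldes and Hammer).  Take disjoint
   anticomplete nonempty sets A and C, both without isolated vertices, with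
   |A| + |C| maximum.  The other vertices are either in N, and then they have a
   neighbour in every component of G[A] and of G[C], or in T, which is stable
   and anticomplete to A and C.  Excluding P5, its complement and C5, a vertex of N
   is complete to A or to C, nonadjacent vertices of N have the same neighbours
   in A and in C, and every clique contained in N has a common neighbour in A
   whenever it has one in C, and conversely.
   If N is a clique, then G is a split unification along (A, N, C, T).
   Otherwise N has a nontrivial anticomponent X; only vertices of T can be mixed
   on X, and these form a clique of the complement of G.  If there are none, then X is a
   homogeneous set and G is a substitution.  Otherwise the complement of G is a
   split unification in which X plays the role of A, provided X is chosen with
   as many complete vertices in T as possible.
   Conversely, no obstruction arises in a split unification: assign a part to each
   of the five vertices; in every assignment that respects the adjacencies of the
   parts, at most one vertex is in A and behaves like a*, or at most one is in C
   and behaves like c*, so the obstruction is present in G_2 or in G_1.  This is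
   a finite check. *)
Require Import Defs.
From mathcomp Require Import all_boot.

Set Implicit Arguments.
Unset Strict Implicit.
Unset Printing Implicit Defensive.

(** * Obstructions *)

Definition path5 : rel nat := fun i j => (i.+1 == j) || (j.+1 == i).
Definition copath5 : rel nat := fun i j => (i != j) && ~~ path5 i j.
Definition cycle5 : rel nat := fun i j => (i.+1 %% 5 == j) || (j.+1 %% 5 == i).

(** Every index from 2 on denotes the 5-cycle, so a quantifier over [k] ranges over exactly the
    three forbidden graphs. Vertices are plain numbers, so that statements about all of them can be
    settled by evaluating [all5]. *)
Definition obstruction (k : nat) : rel nat :=
  match k with 0 => path5 | 1 => copath5 | _ => cycle5 end.

Definition all5 (p : pred nat) : bool := all p (iota 0 5).

Lemma all5P (p : pred nat) : reflect (forall i, i < 5 -> p i) (all5 p).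
Proof.
by apply: (iffP allP) => h i; [move=> lti | rewrite mem_iota => lti]; apply: h;
  rewrite ?mem_iota.
Qed.

(* Repetitions in [v] are excluded by lemma [occurrence_inj], because no two
   vertices of an obstruction have the same neighbours. *)
Definition occurrence (V : finType) (G : rel V) (h : rel nat) (v : nat -> V) :=
  forall i j, i < 5 -> j < 5 -> G (v i) (v j) = h i j.

Definition occurs (V : finType) (G : rel V) (h : rel nat) : Prop :=
  exists v, occurrence G h v.

Lemma obstruction_twinfree k i j : i < 5 -> j < 5 ->
  (forall l, l < 5 -> obstruction k i l = obstruction k j l) -> i = j.
Proof.
move=> lti ltj hl; apply/eqP; move: {hl}(introT (all5P _) (fun l lt5 =>
  introT eqP (hl l lt5))); apply/implyP.
move: j ltj; apply/all5P; move: i lti; apply/all5P.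
by case: k => [|[|k]]; vm_compute.
Qed.

Lemma occurrence_inj (V : finType) (G : rel V) k v i j :
  occurrence G (obstruction k) v -> i < 5 -> j < 5 -> v i = v j -> i = j.
Proof.
move=> occ lti ltj eqv; apply: (@obstruction_twinfree k) => // l ltl.
by rewrite -!occ // eqv.
Qed.

Lemma has_induced_occurs (V : finType) (G : sgraph V) (H : sgraph 'I_5) k :
  (forall i j, H i j = obstruction k i j) ->
  has_induced G H <-> occurs G (obstruction k).
Proof.
move=> defH; split=> [[S [f [g fK gK] fG]]|[v occ]].
  exists (fun i => val (g (inord i))) => i j lti ltj.
  rewrite -[LHS]/(induced G S (g (inord i)) (g (inord j))) -fG !gK defH.
  by rewrite !inordK.
pose S := [set v i | i : 'I_5].
have vS (i : 'I_5) : v i \in S by apply/imsetP; exists i.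
pose g (i : 'I_5) : {x | x \in S} := exist _ (v i) (vS i).
have g_inj : injective g.
  by move=> i j [] /(occurrence_inj occ) eqv; apply/val_inj/eqv.
have v_inj : injective (fun i : 'I_5 => v i).
  by move=> i j eqv; apply: g_inj; apply: val_inj.
have /(inj_card_bij g_inj) [f gK fK] : #|{: {x | x \in S}}| <= #|'I_5|.
  by rewrite card_sig (card_imset _ v_inj).
exists S, f; first by exists g.
by move=> x y; rewrite defH -occ // -{2}[x]fK -{2}[y]fK.
Qed.

Lemma freeP (V : finType) (G : sgraph V) :
  P5_coP5_C5_free G <-> forall k, ~ occurs G (obstruction k).
Proof.
have hP : has_induced G P5 <-> occurs G (obstruction 0).
  by apply: has_induced_occurs => i j.
have hQ : has_induced G (compl P5) <-> occurs G (obstruction 1).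
  by apply: has_induced_occurs => i j.
have hC k : has_induced G C5 <-> occurs G (obstruction k.+2).
  apply: has_induced_occurs => i j /=.
  by rewrite /C5_rel /cycle5 -!val_eqE /=.
split=> [[nP nQ nC] [|[|k]]|nO]; first by move/hP.
- by move/hQ.
- by move/hC.
by split=> [/hP|/hQ|/(hC 0)]; apply: nO.
Qed.

Lemma occurs_map (V W : finType) (G : rel V) (H : rel W) (f : V -> W) h :
  (forall x y, H (f x) (f y) = G x y) -> occurs G h -> occurs H h.
Proof.
by move=> fG [v occ]; exists (f \o v) => i j lti ltj /=; rewrite fG occ.
Qed.

(** Of use beyond embeddings: vertices merged by [f] are twins in [G], and an obstruction contains
    no twins, so its image is again an obstruction. *)
Lemma free_map (V W : finType) (G : sgraph V) (H : sgraph W) (f : V -> W) :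
  (forall x y, H (f x) (f y) = G x y) ->
  P5_coP5_C5_free H -> P5_coP5_C5_free G.
Proof. by move=> fG /freeP nO; apply/freeP => k /(occurs_map fG) /nO. Qed.

Lemma occurs_compl (V : finType) (G : sgraph V) k :
  occurs (compl G) (obstruction k) -> exists l, occurs G (obstruction l).
Proof.
case=> v occ; have inj i j := @occurrence_inj _ _ _ _ i j occ.
have coG i j : i < 5 -> j < 5 -> G (v i) (v j) = (i != j) && ~~ obstruction k i j.
  move=> lti ltj; rewrite -occ //= /compl_rel.
  case: (eqVneq i j) => [->|nij] /=; first by rewrite adj_irr.
  by rewrite (contra_neq (inj _ _ lti ltj) nij) negbK.
(* The 5-cycle is self-complementary through multiplication by 2 modulo 5; the path and its
   complement are exchanged by the identity. *)
pose s i := if k is k'.+2 then (2 * i) %% 5 else i.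
have lts i : i < 5 -> s i < 5 by case: k {occ coG inj} @s => [|[|k]] //=; rewrite ltn_pmod.
exists (match k with 0 => 1 | 1 => 0 | _ => 2 end); exists (v \o s) => i j lti ltj.
rewrite /= coG ?lts //; apply/eqP; move: j ltj; apply/all5P; move: i lti; apply/all5P.
by case: k {occ coG inj lts} @s => [|[|k]]; vm_compute.
Qed.

Lemma free_compl (V : finType) (G : sgraph V) :
  P5_coP5_C5_free G -> P5_coP5_C5_free (compl G).
Proof. by move=> /freeP nO; apply/freeP => k /occurs_compl [l] /nO. Qed.

Lemma compl_involutive (V : finType) (G : sgraph V) x y :
  compl (compl G) x y = G x y.
Proof.
by rewrite /= /compl_rel /= /compl_rel; case: eqVneq => [->|_] /=;
  rewrite ?adj_irr ?negbK.
Qed.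

Lemma free_of_compl (V : finType) (G : sgraph V) :
  P5_coP5_C5_free (compl G) -> P5_coP5_C5_free G.
Proof.
move/free_compl; apply: (@free_map _ _ _ _ id) => x y.
exact: compl_involutive.
Qed.

Lemma occurs_induced (V : finType) (G : sgraph V) (S : {set V}) h v :
  (forall i, i < 5 -> v i \in S) -> occurrence G h v -> occurs (induced G S) h.
Proof.
move=> vS occ; pose v0 : {x | x \in S} := exist _ (v 0) (vS 0 isT).
exists (fun i => insubd v0 (v i)) => i j lti ltj.
by rewrite /= /induced_rel !insubdK ?occ //; [exact: (vS j) | exact: (vS i)].
Qed.

Lemma split_free (V : finType) (G : sgraph V) :
  split_graph G -> P5_coP5_C5_free G.
Proof.
case=> K clK stK; apply/freeP => k [v occ].
have inj i j := @occurrence_inj _ _ _ _ i j occ.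
have: all5 (fun i => all5 (fun j => [&& v i \in K, v j \in K & i != j] ==>
    obstruction k i j) && all5 (fun j => (v i \notin K) && (v j \notin K) ==>
    ~~ obstruction k i j)).
  apply/all5P => i lti; apply/andP; split; apply/all5P => j ltj; apply/implyP.
    case/and3P=> iK jK nij; rewrite -occ //.
    by apply: clK => //; apply: contra_neq nij; apply: inj.
  by case/andP=> iK jK; rewrite -occ //; apply: stK; rewrite inE.
rewrite /all5 /=.
move: (v 0 \in K) (v 1 \in K) (v 2 \in K) (v 3 \in K) (v 4 \in K).
by case: k {occ inj} => [|[|k]] [] [] [] [] [].
Qed.

(** * The operations preserve the class *)

(** The vertices of an obstruction that fall in [H] form a module, and the obstructions are prime:
    either all five lie in [H], or at most one does and [x] can stand for it in [G0]. *)
Lemma substitution_free (V W : finType) (G0 : sgraph V) (x : V) (H : sgraph W) :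
  P5_coP5_C5_free G0 -> P5_coP5_C5_free H ->
  P5_coP5_C5_free (substitution G0 x H).
Proof.
move=> /freeP nO0 /freeP nOH; apply/freeP => k [v occ].
pose inH i := if v i is inr _ then true else false.
pose phi i : V := if v i is inl y then val y else x.
have mod1 : all5 (fun i => all5 (fun j => all5 (fun l =>
    [&& inH i, inH j & ~~ inH l] ==> (obstruction k i l == obstruction k j l)))).
  apply/all5P => i lti; apply/all5P => j ltj; apply/all5P => l ltl.
  apply/implyP => /and3P[]; rewrite -!occ // /inH.
  by case: (v i) (v j) (v l) => [?|?] [?|?] [?|?].
have notall : ~~ all5 inH.
  apply/negP => /all5P allH; move: (allH 0 isT); rewrite {1}/inH.
  case: (v 0) => [//|w0] _.
  apply: (nOH k).
  exists (fun i => if v i is inr w then w else w0) => i j lti ltj.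
  move: (allH i lti) (allH j ltj); rewrite -occ // /inH.
  by case: (v i) (v j) => [?|?] [?|?].
have two : ~~ all5 (fun i => all5 (fun j => inH i && inH j ==> (i == j))).
  apply/negP => /all5P one; apply: (nO0 k); exists phi => i j lti ltj.
  have /all5P/(_ j ltj)/implyP := one i lti.
  rewrite -occ // /inH /phi; case Ei: (v i) => [y|h]; case Ej: (v j) => [z|h'] //=.
  move=> /(_ isT)/eqP eqij; move: Ei; rewrite eqij Ej => -[->].
  by rewrite !adj_irr.
move: mod1 notall two; rewrite /all5 /=.
move: (inH 0) (inH 1) (inH 2) (inH 3) (inH 4).
by case: k {occ} => [|[|k]] [] [] [] [] [].
Qed.

(** * The finite check for split unifications *)

Definition all5_classes (p : seq nat -> bool) : bool :=
  all5 (fun a => all5 (fun b => all5 (fun c => all5 (fun d => all5 (fun e =>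
    p [:: a; b; c; d; e]))))).

Lemma all5_classesP p (k : nat -> nat) :
  all5_classes p -> (forall i, k i < 5) -> p (mkseq k 5).
Proof.
move=> pT ltk; rewrite /mkseq /=.
move/all5P: pT => /(_ (k 0) (ltk 0)) /all5P /(_ (k 1) (ltk 1)).
move=> /all5P /(_ (k 2) (ltk 2)) /all5P /(_ (k 3) (ltk 3)).
by move=> /all5P /(_ (k 4) (ltk 4)).
Qed.

(* The adjacency prescribed between two of the parts A, B, C, L, T of a split
   unification, numbered 0, 1, 2, 3, 4 in this order. *)
Definition part_adj (p q : nat) : option bool :=
  match p, q with
  | 0, 1 | 1, 0 | 1, 3 | 3, 1 | 2, 3 | 3, 2 | 3, 3 => Some true
  | 0, 2 | 2, 0 | 0, 4 | 4, 0 | 2, 4 | 4, 2 | 4, 4 => Some false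
  | _, _ => None
  end.

Definition parts_ok (h : rel nat) (k : nat -> nat) : bool :=
  all5 (fun i => all5 (fun j => (i != j) ==>
    (if part_adj (k i) (k j) is Some b then h i j == b else true))).

Definition anticomponents_ok (h : rel nat) (k : nat -> nat) : bool :=
  all5 (fun i => all5 (fun j => all5 (fun l =>
    [&& k i == 1, k j == 1, k l == 2, i != j & ~~ h i j] ==>
    (h l i == h l j)))).

(* At most one vertex lies in part p (A or C), and its neighbours are those of
   the marker vertex that stands for p, namely B and L. *)
Definition marker_ok (h : rel nat) (k : nat -> nat) (p : nat) : bool :=
  all5 (fun i => all5 (fun j => (k i == p) ==>
    (if k j == p then i == j else h i j == ((k j == 1) || (k j == 3))))).

(** Settled by evaluating all [5 ^ 5] assignments of parts for each of the three obstructions. *)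
Lemma unification_obstruction m (k : nat -> nat) : (forall i, k i < 5) ->
  parts_ok (obstruction m) k -> anticomponents_ok (obstruction m) k ->
  marker_ok (obstruction m) k 0 || marker_ok (obstruction m) k 2.
Proof.
move=> ltk.
pose P s := let f := nth 0 s in
  parts_ok (obstruction m) f ==> anticomponents_ok (obstruction m) f ==>
  (marker_ok (obstruction m) f 0 || marker_ok (obstruction m) f 2).
have /all5_classesP /(_ ltk) : all5_classes P.
  by rewrite /P; case: m {P} => [|[|m]]; vm_compute.
by move=> /implyP Pk pk ak; apply: (implyP (Pk pk)).
Qed.

Lemma anticomponent_nonadj (V : finType) (G : sgraph V) (S : {set V}) b b' :
  b \in S -> b' \in S -> b != b' -> ~~ G b b' ->
  exists X, [/\ anticomponent G S X, b \in X & b' \in X].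
Proof.
move=> bS b'S nb nGb; pose u : {x | x \in S} := exist _ b bS.
pose u' : {x | x \in S} := exist _ b' b'S.
pose K := [set y | connect (compl (induced G S)) u y].
exists [set val x | x in K]; split; first by exists K => //; exists u.
  by apply/imsetP; exists u; rewrite // inE connect0.
apply/imsetP; exists u'; rewrite // inE; apply: connect1.
by rewrite /= /compl_rel /= /induced_rel /= nGb andbT -val_eqE.
Qed.

(** Adjacency to [v] cannot change along a path of nonadjacent vertices of [S], and such paths span
    an anticomponent. *)
Lemma anticomponent_not_mixed (V : finType) (G : sgraph V) (S X : {set V}) v :
  {in S &, forall b b', b != b' -> ~~ G b b' -> G v b = G v b'} ->
  anticomponent G S X -> ~ mixed G v X.
Proof.
move=> vS [K [x ->] ->] [ncv nav].
have vK y : connect (compl (induced G S)) x y -> G v (val y) = G v (val x).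
  have cl : closed (compl (induced G S)) [pred z : {z | z \in S} | G v (val z)].
    move=> z w /andP[nzw nGzw]; rewrite !inE.
    by apply: vS; rewrite ?(valP z) ?(valP w).
  by move/(closed_connect cl); rewrite !inE => ->.
case vx: (G v (val x)).
  by apply: ncv => _ /imsetP[y + ->]; rewrite inE => /vK ->.
by apply: nav => _ /imsetP[y + ->]; rewrite inE => /vK ->; rewrite vx.
Qed.

Lemma not_mixedP (V : finType) (G : sgraph V) v (X : {set V}) x y :
  ~ mixed G v X -> x \in X -> y \in X -> G v x = G v y.
Proof.
move=> nm xX yX; apply/idP/idP => vG; apply/negPn/negP => nG; case: nm.
  split=> [/(_ y yX)|/(_ x xX)]; first by rewrite (negPf nG).
  by rewrite vG.
split=> [/(_ x xX)|/(_ y yX)]; first by rewrite (negPf nG).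
by rewrite vG.
Qed.

(** * Split unification preserves the class *)

Section UnificationFree.
Variables (V : finType) (A B C L T : {set V}) (a c : V) (E1 E2 : sgraph V).
Hypothesis cp : composable_pair A B C L T a c E1 E2.

Let part (x : V) : nat :=
  if x \in A then 0 else if x \in B then 1 else if x \in C then 2
  else if x \in L then 3 else 4.

Let ltpart x : part x < 5.
Proof. by rewrite /part; do 4!case: ifP => // _. Qed.

Let partP x : x \in pair_V A B C L T ->
  [/\ (x \in A) = (part x == 0), (x \in B) = (part x == 1),
      (x \in C) = (part x == 2), (x \in L) = (part x == 3)
    & (x \in T) = (part x == 4)].
Proof.
have := cp_disjoint cp; rewrite /= !andbT => /and4P[].
case/and4P=> AB AC AL AT /and3P[BC BL BT] /andP[CL CT] LT.
have dis (X Y : {set V}) : [disjoint X & Y] -> x \in X -> (x \in Y) = false.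
  by move=> XY xX; apply: (disjointFr XY).
rewrite !inE /part; case: ifP => [xA _|_].
  by rewrite !(dis _ _ _ xA).
case: ifP => [xB _|_]; first by rewrite !(dis _ _ _ xB).
case: ifP => [xC _|_]; first by rewrite !(dis _ _ _ xC).
by case: ifP => [xL _|_ /= ->] //; rewrite !(dis _ _ _ xL).
Qed.

Let U := SGraph (unif_rel_sym A B C L T E1 E2) (unif_rel_irr A B C L T E1 E2).

Let U1 x y : x \in pair_V A B C L T -> y \in pair_V A B C L T ->
  part x != 2 -> part y != 2 -> U x y = E1 x y.
Proof.
move=> xV yV; rewrite /= /unif_rel.
have [xA xB xC xL xT] := partP xV; have [yA yB yC yL yT] := partP yV.
move: (@cp2_agree _ _ _ _ _ _ _ _ _ _ cp x y).
rewrite !inE xA xB xC xL xT yA yB yC yL yT.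
move: (part x) (ltpart x) (part y) (ltpart y).
by do 5?[case=> //]; move=> _; do 5?[case=> //] => _ /= agr _ _;
  rewrite ?orbF // agr // orbb.
Qed.

Let U2 x y : x \in pair_V A B C L T -> y \in pair_V A B C L T ->
  part x != 0 -> part y != 0 -> U x y = E2 x y.
Proof.
move=> xV yV; rewrite /= /unif_rel.
have [xA xB xC xL xT] := partP xV; have [yA yB yC yL yT] := partP yV.
move: (@cp2_agree _ _ _ _ _ _ _ _ _ _ cp x y).
rewrite !inE xA xB xC xL xT yA yB yC yL yT.
move: (part x) (ltpart x) (part y) (ltpart y).
by do 5?[case=> //]; move=> _; do 5?[case=> //] => _ /= agr _ _;
  rewrite ?orbF // agr // orbb.
Qed.

Let U_part_adj x y : x \in pair_V A B C L T -> y \in pair_V A B C L T ->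
  x != y -> if part_adj (part x) (part y) is Some b then U x y = b else True.
Proof.
move=> xV yV nxy; have u1 := U1 xV yV; have u2 := U2 xV yV.
have [xA xB xC xL xT] := partP xV; have [yA yB yC yL yT] := partP yV.
have AC p q : p \in A -> q \in C -> part p = 0 -> part q = 2 -> U p q = false.
  move=> pA qC p0 q2.
  have pV : p \in pair_V A B C L T by rewrite !inE pA.
  have qV : q \in pair_V A B C L T by rewrite !inE qC !orbT.
  have [? pB pC pL pT] := partP pV; have [qA qB ? qL qT] := partP qV.
  by rewrite /= /unif_rel !inE pA qC pB pC pL pT qA qB qL qT p0 q2.
move: xA xB xC xL xT yA yB yC yL yT u1 u2 (AC x y) (AC y x).
move: (part x) (ltpart x) (part y) (ltpart y) => [|[|[|[|[|//]]]]] _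
  [|[|[|[|[|//]]]]] _ //= xA xB xC xL xT yA yB yC yL yT u1 u2 ac ca.
- by rewrite u1 //; apply: (cp1_AB cp).
- exact: ac.
- by rewrite u1 //; apply: negbTE; apply: (cp1_AT cp).
- by rewrite u1 // adj_sym; apply: (cp1_AB cp).
- by rewrite u2 // adj_sym; apply: (cp2_LBC cp); rewrite // inE xB.
- by move: ca; rewrite /= unif_rel_sym; apply.
- by rewrite u2 // adj_sym; apply: (cp2_LBC cp); rewrite // inE xC orbT.
- by rewrite u2 // adj_sym; apply: negbTE; apply: (cp2_TC cp).
- by rewrite u2 //; apply: (cp2_LBC cp); rewrite // inE yB.
- by rewrite u2 //; apply: (cp2_LBC cp); rewrite // inE yC orbT.
- by rewrite u1 //; apply: (cp1_L cp).
- by rewrite u1 // adj_sym; apply: negbTE; apply: (cp1_AT cp).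
- by rewrite u2 //; apply: negbTE; apply: (cp2_TC cp).
- by rewrite u1 //; apply: negbTE; apply: (cp1_T cp).
Qed.

Lemma split_unification_free :
  P5_coP5_C5_free (pair_G1 A B L T c E1) ->
  P5_coP5_C5_free (pair_G2 B C L T a E2) ->
  P5_coP5_C5_free (split_unification A B C L T E1 E2).
Proof.
move=> /freeP nO1 /freeP nO2; apply/freeP => m [u occ].
pose v i := val (u i); have vV i : v i \in pair_V A B C L T by apply: valP.
have {}occ : occurrence U (obstruction m) v by move=> i j; apply: occ.
have inj i j := @occurrence_inj _ _ _ _ i j occ.
have pok : parts_ok (obstruction m) (part \o v).
  apply/all5P => i lti; apply/all5P => j ltj; apply/implyP => nij.
  have := U_part_adj (vV i) (vV j) (contra_neq (inj _ _ lti ltj) nij).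
  by rewrite /=; case: part_adj => // b <-; rewrite -occ.
have aok : anticomponents_ok (obstruction m) (part \o v).
  apply/all5P => i lti; apply/all5P => j ltj; apply/all5P => l ltl.
  apply/implyP => /and5P[/= /eqP iB /eqP jB /eqP lC nij].
  rewrite -!occ // !U2 ?iB ?jB ?lC // => nGij.
  have [_ iB' _ _ _] := partP (vV i); have [_ jB' _ _ _] := partP (vV j).
  have [_ _ lC' _ _] := partP (vV l).
  have [||||X [antiX iX jX]] := @anticomponent_nonadj _ E2 B (v i) (v j) => //.
  - by rewrite iB' iB.
  - by rewrite jB' jB.
  - exact: contra_neq (inj _ _ lti ltj) nij.
  apply/eqP; apply: not_mixedP iX jX; apply: (cp2_mixed cp) antiX.
  by rewrite lC' lC.
have /orP[/all5P mA|/all5P mC] :=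
    unification_obstruction (fun i => ltpart (v i)) pok aok.
  (* The single vertex in [A], if any, is replaced by the marker [a], which carries the obstruction
     into the second graph of the pair. *)
  pose w i := if part (v i) == 0 then a else v i.
  apply: (nO2 m); apply: (@occurs_induced _ _ _ _ w) => [i lti|i j lti ltj].
    rewrite /w /pair_V2; case: ifP => [_|i0]; first by rewrite !inE eqxx.
    have := vV i; have [iA _ _ _ _] := partP (vV i).
    by rewrite !inE iA i0 /= => ->; rewrite orbT.
  have aj l : part (v l) != 0 ->
      E2 a (v l) = (part (v l) == 1) || (part (v l) == 3).
    have := vV l; have [iA iB iC iL iT] := partP (vV l).
    move: (cp2_a cp (x := v l)) (cp2_a_anti cp (x := v l)).
    rewrite !inE iA iB iC iL iT.
    by move: (part (v l)) (ltpart (v l)) => [|[|[|[|[|//]]]]] _ //= p q _ _;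
      first [by rewrite p | by rewrite (negPf (q _))].
  have /all5P/(_ j ltj) /= := mA i lti; have /all5P/(_ i lti) /= := mA j ltj.
  rewrite /w; case: ifP => [i0|/negbT i0]; case: ifP => [j0|/negbT j0] /=.
  - by move=> /eqP -> _; rewrite adj_irr -occ // adj_irr.
  - by rewrite aj // => _ /eqP <-.
  - by rewrite adj_sym aj // => /eqP <- _; rewrite -!occ // adj_sym.
  - by rewrite -U2 // occ.
pose w i := if part (v i) == 2 then c else v i.
apply: (nO1 m); apply: (@occurs_induced _ _ _ _ w) => [i lti|i j lti ltj].
  rewrite /w /pair_V1; case: ifP => [_|i0]; first by rewrite !inE eqxx.
  have := vV i; have [_ _ iC _ _] := partP (vV i).
  by rewrite !inE iC i0 /= orbF => ->; rewrite orbT.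
have cj l : part (v l) != 2 ->
    E1 c (v l) = (part (v l) == 1) || (part (v l) == 3).
  have := vV l; have [iA iB iC iL iT] := partP (vV l).
  move: (cp1_c cp (x := v l)) (cp1_c_anti cp (x := v l)).
  rewrite !inE iA iB iC iL iT.
  by move: (part (v l)) (ltpart (v l)) => [|[|[|[|[|//]]]]] _ //= p q _ _;
    first [by rewrite p | by rewrite (negPf (q _))].
have /all5P/(_ j ltj) /= := mC i lti; have /all5P/(_ i lti) /= := mC j ltj.
rewrite /w; case: ifP => [i2|/negbT i2]; case: ifP => [j2|/negbT j2] /=.
- by move=> /eqP -> _; rewrite adj_irr -occ // adj_irr.
- by rewrite cj // => _ /eqP <-.
- by rewrite adj_sym cj // => /eqP <- _; rewrite -!occ // adj_sym.
- by rewrite -U1 // occ.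
Qed.

End UnificationFree.

Lemma isomorphic_free (V W : finType) (G : sgraph V) (H : sgraph W) :
  isomorphic G H -> P5_coP5_C5_free H -> P5_coP5_C5_free G.
Proof. by case=> f _; apply: free_map. Qed.

Lemma from_substitution_free (V : finType) (G : sgraph V) :
  from_substitution P5_coP5_C5_free G -> P5_coP5_C5_free G.
Proof.
case=> [V0 [W [G0 [H [x [_ _ f0 fH /isomorphic_free]]]]]]; apply.
exact: substitution_free.
Qed.

Lemma from_split_unification_free (V : finType) (G : sgraph V) :
  from_split_unification P5_coP5_C5_free G -> P5_coP5_C5_free G.
Proof.
case=> [W [A [B [C [L [T [a [c [E1 [E2 [cp [_ _ f1 f2 /isomorphic_free]]]]]]]]]]]].
by apply; apply: split_unification_free cp f1 f2.
Qed.

(** * Homogeneous sets and split divides *)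

Lemma inj_surj_bij (U V : finType) (g : U -> V) :
  injective g -> (forall v, exists u, g u = v) -> bijective g.
Proof.
move=> g_inj g_surj; apply: (inj_card_bij g_inj).
rewrite -(card_codom g_inj) subset_leq_card //; apply/subsetP => v _.
by have [u <-] := g_surj v; apply: codom_f.
Qed.

Lemma isomorphic_sym_map (U V : finType) (G : sgraph V) (H : sgraph U)
    (g : U -> V) : bijective g -> (forall u w, G (g u) (g w) = H u w) ->
  isomorphic G H.
Proof.
case=> f gK fK gH; exists f; first by exists g.
by move=> x y; rewrite -gH !fK.
Qed.

Definition homogeneous (V : finType) (G : sgraph V) (X : {set V}) : Prop :=
  [/\ 1 < #|X|, #|X| < #|V|
    & forall v x y, v \notin X -> x \in X -> y \in X -> G v x = G v y].

Lemma homogeneous_compl (V : finType) (G : sgraph V) X :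
  homogeneous (compl G) X -> homogeneous G X.
Proof.
case=> X1 XV hX; split=> // v x y vX xX yX; have := hX v x y vX xX yX.
rewrite /= /compl_rel.
have [-> ->] : v != x /\ v != y by split; apply: contraNneq vX => ->.
by move/negb_inj.
Qed.

(** One vertex [x0] of [X] is kept and the graph induced on [X] is substituted for it. The lower
    bound on the size of [X] makes the first factor smaller than [G], the upper bound the second. *)
Lemma homogeneous_substitution (V : finType) (G : sgraph V) X :
  P5_coP5_C5_free G -> homogeneous G X -> from_substitution P5_coP5_C5_free G.
Proof.
move=> fG [X1 XV hX]; have /card_gt0P[x0 x0X] := ltnW X1.
pose S := x0 |: ~: X; have x0S : x0 \in S by rewrite !inE eqxx.
exists {x | x \in S}, {x | x \in X}, (induced G S), (induced G X),
  (exist _ x0 x0S); split; first 1 last.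
- by rewrite card_sig.
- exact: (@free_map _ _ _ _ val) fG.
- exact: (@free_map _ _ _ _ val) fG.
- pose g (u : {y : {x | x \in S} | y != exist _ x0 x0S} + {x | x \in X}) : V :=
    match u with inl y => val (val y) | inr w => val w end.
  have notX (y : {y : {x | x \in S} | y != exist _ x0 x0S}) :
      val (val y) \notin X.
    have := valP (val y); rewrite !inE; case/orP => // /eqP eqy.
    by case/negP: (valP y); apply/eqP/val_inj.
  apply: (@isomorphic_sym_map _ _ _ _ g).
    apply: inj_surj_bij => [[y|w] [z|w'] /= eqg|v].
    - by congr inl; do 2!apply: val_inj.
    - by case/negP: (notX y); rewrite (eqg : val (val y) = val w') (valP w').
    - by case/negP: (notX z); rewrite -(eqg : val w = val (val z)) (valP w).
    - by congr inr; apply: val_inj.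
    have [vX|vX] := boolP (v \in X); first by exists (inr (exist _ v vX)).
    have vS : v \in S by rewrite !inE vX orbT.
    have vn : exist _ v vS != exist _ x0 x0S :> {x | x \in S}.
      by apply/eqP => -[eqv]; rewrite eqv x0X in vX.
    by exists (inl (exist _ (exist _ v vS) vn)).
  move=> [y|w] [z|w'] //=; rewrite /induced_rel /=.
    by apply: hX; rewrite ?(valP w') ?notX.
  by rewrite adj_sym [RHS]adj_sym; apply: hX; rewrite ?(valP w) ?notX.
rewrite card_sig cardsU1 !inE x0X /= add1n.
by rewrite -(cardsC X) -[#|~: X|.+1]add1n ltn_add2r.
Qed.

(** A split unification seen inside the finished graph, without markers: a vertex of [A] complete to
    [L] has the adjacencies required of the marker [a], and a vertex of [C] complete to [B] those of
    [c]. Two vertices in each of [A] and [C] make both graphs of the pair smaller. *)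
Record split_divide (V : finType) (G : sgraph V) (A B C L T : {set V}) : Prop :=
  SplitDivide {
  sd_disjoint :
    pairwise (fun X Y : {set V} => [disjoint X & Y]) [:: A; B; C; L; T];
  sd_cover : forall x, x \in A :|: B :|: C :|: L :|: T;
  sd_A : 1 < #|A|;
  sd_C : 1 < #|C|;
  sd_L : clique G L;
  sd_T : stable G T;
  sd_AB : complete_set G A B;
  sd_AC : anticomplete_set G A C;
  sd_AT : anticomplete_set G A T;
  sd_AL : exists2 v, v \in A & complete G v L;
  sd_TC : anticomplete_set G T C;
  sd_LBC : complete_set G L (B :|: C);
  sd_CB : exists2 v, v \in C & complete G v B;
  sd_mixed : forall v, v \in C ->
    {in B &, forall b b', b != b' -> ~~ G b b' -> G v b = G v b'}
}.

(** * Recovering a composable pair from a split divide *)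

Section Divide.
Variables (V : finType) (G : sgraph V) (A B C L T : {set V}) (a0 c0 : V).
Hypotheses (fG : P5_coP5_C5_free G) (sd : split_divide G A B C L T).
Hypotheses (a0A : a0 \in A) (a0L : complete G a0 L).
Hypotheses (c0C : c0 \in C) (c0B : complete G c0 B).

(** The ambient type has two new points for the markers, [inr false] being a twin of [a0] and
    [inr true] of [c0]. All adjacencies are pulled back along [f], so both graphs of the pair are in
    the class by [free_map]. *)
Let f (w : V + bool) : V :=
  match w with inl v => v | inr false => a0 | inr true => c0 end.

Let pull : rel (V + bool)%type := fun x y => G (f x) (f y).
Let pull_sym : symmetric pull. Proof. by move=> x y; apply: adj_sym. Qed.
Let pull_irr : irreflexive pull. Proof. by move=> x; apply: adj_irr. Qed.
Let E : sgraph (V + bool)%type := SGraph pull_sym pull_irr.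

Let inj_inl : injective (@inl V bool). Proof. by move=> x y []. Qed.

Let lift (X : {set V}) : {set V + bool} := inl @: X.

Let lift_inl X x : (inl x \in lift X) = (x \in X).
Proof. exact: mem_imset. Qed.

Let lift_inr X b : (inr b \in lift X) = false.
Proof. by apply/negbTE/imsetP => -[]. Qed.

Let liftP X w : w \in lift X -> exists2 x, x \in X & w = inl x.
Proof. by case/imsetP=> x xX ->; exists x. Qed.

Let liftE := (lift_inl, lift_inr).

Let lift_disjoint X Y : [disjoint lift X & lift Y] = [disjoint X & Y].
Proof. by rewrite imset_disjoint. Qed.

Let disj := sd_disjoint sd.

Let notin (X Y : {set V}) x : [disjoint X & Y] -> x \in X -> x \notin Y.
Proof. by move=> XY xX; rewrite (disjointFr XY). Qed.

Let divide_composable : composable_pair (lift A) (lift B) (lift C) (lift L)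
  (lift T) (inr false) (inr true) E E.
Proof.
move: disj; rewrite /= !andbT => /and4P[].
case/and4P=> AB AC AL AT /and3P[BC BL BT] /andP[CL CT] LT.
split.
- by rewrite /= !lift_disjoint AB AC AL AT BC BL BT CL CT LT.
- by apply/set0Pn; exists (inl a0); rewrite liftE.
- by apply/set0Pn; exists (inl c0); rewrite liftE.
- by rewrite !inE !liftE.
- by rewrite !inE !liftE.
- by [].
- by move=> _ _ /liftP[x xL ->] /liftP[y yL ->] nxy; apply: (sd_L sd) => //.
- by move=> _ _ /liftP[x xT ->] /liftP[y yT ->]; apply: (sd_T sd).
- by move=> _ /liftP[x xA ->] _ /liftP[y yB ->]; apply: (sd_AB sd).
- by move=> _ /liftP[x xA ->] _ /liftP[y yT ->]; apply: (sd_AT sd).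
- exists (inl a0); first by rewrite liftE.
  by move=> _ /liftP[x xL ->]; apply: a0L.
- move=> w; rewrite inE => /orP[] /liftP[x xX ->]; first exact: c0B.
  by rewrite /= /pull /= adj_sym; apply: (sd_LBC sd); rewrite // inE c0C orbT.
- move=> w; rewrite inE => /orP[] /liftP[x xX ->]; rewrite /= /pull /= adj_sym.
    exact: (sd_AC sd).
  exact: (sd_TC sd).
- by [].
- by move=> _ /liftP[x xT ->] _ /liftP[y yC ->]; apply: (sd_TC sd).
- move=> _ /liftP[x xL ->] w; rewrite inE => /orP[] /liftP[y yX ->];
    by apply: (sd_LBC sd); rewrite // inE yX ?orbT.
- move=> w; rewrite inE => /orP[] /liftP[x xX ->]; last exact: a0L.
  exact: (sd_AB sd).
- move=> w; rewrite inE => /orP[] /liftP[x xX ->]; first exact: (sd_AC sd).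
  exact: (sd_AT sd).
- exists (inl c0); first by rewrite liftE.
  by move=> _ /liftP[x xB ->]; apply: c0B.
- move=> _ X /liftP[v vC ->]; apply: anticomponent_not_mixed.
  by move=> _ _ /liftP[x xB ->] /liftP[y yB ->] nxy; apply: (sd_mixed sd) => //.
Qed.

Lemma divide_unification : from_split_unification P5_coP5_C5_free G.
Proof.
exists (V + bool : finType)%type, (lift A), (lift B), (lift C), (lift L),
  (lift T), (inr false), (inr true), E, E; split; first exact: divide_composable.
move: disj; rewrite /= !andbT => /and4P[].
case/and4P=> AB AC AL AT /and3P[BC BL BT] /andP[CL CT] LT.
have small (X : {set V}) (S : {set V + bool}) b : 1 < #|X| ->
    (S \subset inr b |: lift (~: X)) -> #|S| < #|V|.
  move=> X1 /subset_leq_card /leq_ltn_trans; apply.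
  rewrite cardsU1 !liftE /= add1n (card_imset _ inj_inl).
  by rewrite -(cardsC X) -[#|~: X|.+1]add1n ltn_add2r.
split.
- apply: (small C _ true (sd_C sd)); apply/subsetP => -[x|b]; last first.
    by rewrite !inE !liftE !orbF.
  rewrite /pair_V1 !inE !liftE inE /= -!orbA => /or4P[] xX; apply/negP => xC.
  + by case/negP: (notin AC xX).
  + by case/negP: (notin BC xX).
  + by case/negP: (notin CL xC).
  + by case/negP: (notin CT xC).
- apply: (small A _ false (sd_A sd)); apply/subsetP => -[x|b]; last first.
    by rewrite !inE !liftE !orbF.
  rewrite /pair_V2 !inE !liftE inE /= -!orbA => xX; apply/negP => xA.
  move: xX; rewrite (negPf (notin AB xA)) (negPf (notin AC xA)).
  by rewrite (negPf (notin AL xA)) (negPf (notin AT xA)).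
- exact: (@free_map _ _ _ _ (f \o val)) fG.
- exact: (@free_map _ _ _ _ (f \o val)) fG.
pose S := pair_V (lift A) (lift B) (lift C) (lift L) (lift T).
have liftS x : inl x \in S.
  by have := sd_cover sd x; rewrite !inE !liftE.
have Sinl (u : {x | x \in S}) : exists x, u = exist _ (inl x) (liftS x).
  case: u => -[x|b] uS; first by exists x; apply: val_inj.
  by exfalso; move: uS; rewrite !inE !liftE.
apply: (@isomorphic_sym_map _ _ _ _ (f \o val)).
  apply: inj_surj_bij => [u u'|v]; last by exists (exist _ (inl v) (liftS v)).
  have [x ->] := Sinl u; have [y ->] := Sinl u'; move=> /= eqxy.
  by apply: val_inj; rewrite /= eqxy.
move=> u u'; have [x ->] := Sinl u; have [y ->] := Sinl u'.
rewrite /= /induced_rel /= /unif_rel /= /pull /= !inE !liftE.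
have := sd_cover sd x; have := sd_cover sd y; rewrite !inE.
case Gxy: (G x y); last by rewrite !andbF.
(* An edge never joins [A] to [C], so its ends lie together on one side of the unification. *)
have xy : ~~ ((x \in A) && (y \in C)).
  by apply/negP => /andP[xA yC]; have := sd_AC sd xA yC; rewrite Gxy.
have yx : ~~ ((y \in A) && (x \in C)).
  by apply/negP => /andP[yA xC]; have := sd_AC sd yA xC; rewrite adj_sym Gxy.
move: xy yx; case: (x \in A); case: (y \in A); case: (x \in C); case: (y \in C) => //= _ _;
  case: (x \in B); case: (y \in B) => //=; case: (x \in L);
  by case: (y \in L) => //=; case: (x \in T); case: (y \in T).
Qed.

End Divide.

Lemma split_divide_unification (V : finType) (G : sgraph V) A B C L T :
  P5_coP5_C5_free G -> split_divide G A B C L T ->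
  from_split_unification P5_coP5_C5_free G.
Proof.
move=> fG sd; have [[a aA aL] [c cC cB]] := conj (sd_AL sd) (sd_CB sd).
exact: (divide_unification fG sd aA aL cC cB).
Qed.

Lemma from_split_unification_ext (P : graph_class) (V : finType)
    (G H : sgraph V) : (forall x y, G x y = H x y) ->
  from_split_unification P G -> from_split_unification P H.
Proof.
move=> eqGH [W [A [B [C [L [T [a [c [E1 [E2 [cp [h1 h2 f1 f2 [f bf fG]]]]]]]]]]]]].
exists W, A, B, C, L, T, a, c, E1, E2; split=> //; split=> //.
by exists f => // x y; rewrite fG.
Qed.


(** * Graphs without two independent edges *)

Section Forbidden.
Variables (V : finType) (G : sgraph V).
Hypothesis fG : P5_coP5_C5_free G.

Let occurrence_seq k (a b c d e : V) :
  let v := nth a [:: a; b; c; d; e] in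
  all5 (fun i => all5 (fun j => (i < j) ==> (G (v i) (v j) == obstruction k i j))) ->
  False.
Proof.
move=> v /all5P ok; have /freeP/(_ k) := fG; apply; exists v => i j lti ltj.
have lt p q : p < 5 -> q < 5 -> p < q -> G (v p) (v q) = obstruction k p q.
  by move=> ltp ltq ltpq; move/all5P: (ok p ltp) => /(_ q ltq); rewrite ltpq => /eqP.
have symO p q : obstruction k p q = obstruction k q p.
  by case: k {ok lt} => [|[|k]]; rewrite /= /copath5 /path5 /cycle5 orbC // eq_sym.
have irrO : obstruction k i i = false.
  apply/eqP; move: i lti; apply/all5P.
  by case: k {ok lt symO} => [|[|k]]; vm_compute.
case: (ltngtP i j) => [/lt->|/lt ltji|<-] //; first by rewrite adj_sym symO ltji.
by rewrite adj_irr irrO.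
Qed.

Lemma no_path5 a b c d e : G a b -> G b c -> G c d -> G d e ->
  ~~ G a c -> ~~ G a d -> ~~ G a e -> ~~ G b d -> ~~ G b e -> ~~ G c e -> False.
Proof.
move=> ab bc cd de /negbTE ac /negbTE ad /negbTE ae /negbTE bd /negbTE be.
move=> /negbTE ce; apply: (@occurrence_seq 0 a b c d e).
by rewrite /all5 /= ab bc cd de ac ad ae bd be ce.
Qed.

Lemma no_cycle5 a b c d e : G a b -> G b c -> G c d -> G d e -> G e a ->
  ~~ G a c -> ~~ G a d -> ~~ G b d -> ~~ G b e -> ~~ G c e -> False.
Proof.
move=> ab bc cd de; rewrite adj_sym => ae /negbTE ac /negbTE ad.
move=> /negbTE bd /negbTE be /negbTE ce; apply: (@occurrence_seq 2 a b c d e).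
by rewrite /all5 /= ab bc cd de ac ad ae bd be ce.
Qed.

(** The complement of the 5-path is a house: the square [a b c d] with the roof [e] over [a b]. The
    complementary path runs through [a], [c], [e], [d], [b]. *)
Lemma no_house a b c d e : G a b -> G b c -> G c d -> G d a -> G e a -> G e b ->
  ~~ G a c -> ~~ G b d -> ~~ G e c -> ~~ G e d -> False.
Proof.
move=> ab bc cd da ea eb /negbTE ac /negbTE bd /negbTE ec /negbTE ed.
apply: (@occurrence_seq 1 a c e d b).
rewrite /all5 /= ac (adj_sym G a e) ea (adj_sym G a d) da ab.
by rewrite (adj_sym G c e) ec cd (adj_sym G c b) bc ed eb (adj_sym G d b) bd.
Qed.

End Forbidden.

(** The adjacencies force the four vertices to be distinct. In the complement this is an induced
    square. *)
Definition two_edges (V : finType) (G : sgraph V) : bool :=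
  [exists a, exists b, exists c, exists d,
    [&& G a b, G c d, ~~ G a c, ~~ G a d, ~~ G b c & ~~ G b d]].

(** * Split graphs, after Foldes and Hammer *)

Section FoldesHammer.
Variables (V : finType) (G : sgraph V).
Hypothesis fG : P5_coP5_C5_free G.
Hypotheses (no2 : ~~ two_edges G) (no4 : ~~ two_edges (compl G)).

Let no_two_edges a b c d : G a b -> G c d ->
  ~~ G a c -> ~~ G a d -> ~~ G b c -> ~~ G b d -> False.
Proof.
move=> ab cd ac ad bc bd; case/negP: no2; apply/existsP; exists a.
apply/existsP; exists b; apply/existsP; exists c; apply/existsP; exists d.
by rewrite ab cd ac ad bc bd.
Qed.

Let no_square a b c d : a != c -> b != d -> G a b -> G b c -> G c d -> G d a ->
  ~~ G a c -> ~~ G b d -> False.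
Proof.
move=> nac nbd ab bc cd da ac bd; case/negP: no4; apply/existsP; exists a.
apply/existsP; exists c; apply/existsP; exists b; apply/existsP; exists d.
rewrite /= /compl_rel nac nbd ac bd ab (adj_sym G a) da (adj_sym G c b) bc cd.
by rewrite !andbF.
Qed.

Let cliqueb (K : {set V}) : bool :=
  [forall x in K, forall y in K, (x != y) ==> G x y].

Let cliquebP K : reflect (clique G K) (cliqueb K).
Proof.
apply: (iffP forall_inP) => [cK x y xK yK nxy|cK x xK].
  by have /forall_inP/(_ y yK)/implyP := cK x xK; apply.
by apply/forall_inP => y yK; apply/implyP; apply: cK.
Qed.

Let nbrs x := [set y | G x y].
(** A clique of maximum weight is inclusion-maximal, because each vertex counts at least 1, and no
    exchange of one of its vertices that yields a clique can bring in a larger degree. *)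
Let weight (K : {set V}) := \sum_(x in K) #|nbrs x|.+1.

Lemma foldes_hammer : split_graph G.
Proof.
have cl0 : cliqueb set0 by apply/cliquebP => x y; rewrite inE.
pose K := [arg max_(K > set0 | cliqueb K) weight K].
have [clK maxK] : cliqueb K /\ forall K', cliqueb K' -> weight K' <= weight K.
  by rewrite /K; case: arg_maxnP.
move/cliquebP: clK => clK.
have nonnbr x : x \notin K -> exists2 k, k \in K & ~~ G x k.
  move=> xK; apply/exists_inP; rewrite -negb_forall_in.
  apply/negP => /forall_inP xG; suff /maxK : cliqueb (x |: K).
    by rewrite /weight big_setU1 //= leqNgt ltnS leq_addl.
  apply/cliquebP => y z /setU1P[->|yK] /setU1P[->|zK] nyz; last exact: clK.
  - by rewrite eqxx in nyz.
  - exact: xG.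
  - by rewrite adj_sym; apply: xG.
(* [x] misses just one vertex [k] of [K], since two would form an edge independent of [x y].
   Exchanging [k] for [x] shows that [k] has a neighbour [z] missed by [x]; then [z] sees [y], and a
   vertex [k2] of [K] missed by [z] closes a square or a 5-cycle. *)
have core x y : x \notin K -> y \notin K -> G x y ->
    (forall k, k \in K -> ~~ G x k -> ~~ G y k) -> False.
  move=> xK yK xy xyK; have [k kK xk] := nonnbr x xK; have yk := xyK k kK xk.
  have xK' k' : k' \in K -> k' != k -> G x k'.
    move=> k'K nk; apply/negPn/negP => xk'.
    apply: (no_two_edges xy (clK _ _ k'K kK nk)) => //; exact: xyK.
  have degs : #|nbrs x| <= #|nbrs k|.
    have : cliqueb (x |: K :\ k).
      apply/cliquebP => u v /setU1P[->|/setD1P[nu uK]] /setU1P[->|/setD1P[nv vK]] nuv.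
      - by rewrite eqxx in nuv.
      - exact: xK'.
      - by rewrite adj_sym; apply: xK'.
      - exact: clK.
    move/maxK; rewrite /weight big_setU1 ?inE ?(negPf xK) ?andbF //=.
    by rewrite (big_setD1 k kK) /= leq_add2r ltnS.
  have [z kz xz] : exists2 z, G k z & ~~ G x z.
    have /subsetPn[z] : ~~ (nbrs k \subset nbrs x).
      apply/negP => sub; have : nbrs k \proper nbrs x.
        by rewrite properE sub; apply/subsetPn; exists y; rewrite !inE // adj_sym.
      by move/proper_card; rewrite ltnNge degs.
    by rewrite !inE; exists z.
  have zK : z \notin K.
    apply/negP => zK; case/negP: xz; apply: xK' => //.
    by apply: contraTneq kz => ->; rewrite adj_irr.
  have yz : G y z.
    by apply/negPn/negP => yz; apply: (no_two_edges xy kz).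
  have [k2 k2K zk2] := nonnbr z zK.
  have nk2 : k2 != k by apply: contraNneq zk2 => ->; rewrite adj_sym.
  have kk2 : G k k2 by apply: clK; rewrite // eq_sym.
  have xk2 := xK' k2 k2K nk2.
  have [yk2|yk2] := boolP (G y k2).
    apply: (@no_square y z k k2) => //.
    - by apply: contraNneq yK => ->.
    - by apply: contraNneq zK => ->.
    - by rewrite adj_sym.
    - by rewrite adj_sym.
  by apply: (no_cycle5 fG xy yz _ kk2) => //; rewrite adj_sym.
exists K => // x y; rewrite !inE => xK yK; apply/negP => xy.
(* Without a square, the nonneighbours of [x] and of [y] in [K] are nested, so [core] applies to the
   two vertices in one of the two orders. *)
have [/forall_inP sub|] := boolP [forall k in K, ~~ G x k ==> ~~ G y k].
  by apply: (core x y) => // k kK; apply/implyP/sub.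
rewrite negb_forall_in => /exists_inP[k kK]; rewrite negb_imply negbK.
case/andP=> xk yk; apply: (core y x) => //; first by rewrite adj_sym.
move=> k' k'K yk'; apply/negP => xk'.
apply: (@no_square x k' k y) => //.
- by apply: contraNneq xK => ->.
- by apply: contraNneq yK => <-.
- by apply: clK => //; apply: contraNneq xk => <-.
- by rewrite adj_sym.
- by rewrite adj_sym.
- by rewrite adj_sym.
Qed.

End FoldesHammer.

(** * Maximal anticomplete pairs *)

Ltac adj_done := solve [done | rewrite adj_sym; done].

(* v has a neighbour in every component of K. *)
Definition linked (V : finType) (G : sgraph V) (v : V) (K : {set V}) : Prop :=
  forall D : {set V}, D \subset K -> D != set0 -> anticomplete G v D ->
  exists x y, [/\ x \in D, y \in K, y \notin D & G x y].

Section Linked.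
Variables (V : finType) (G : sgraph V).
Hypothesis fG : P5_coP5_C5_free G.

Lemma linked_nbr v (K : {set V}) : K != set0 -> linked G v K ->
  exists2 x, x \in K & G v x.
Proof.
move=> K0 lvK.
have [/exists_inP//|] := boolP [exists x in K, G v x].
rewrite negb_exists_in => /forall_inP aK; have [x [y [_ yK]]] := lvK K (subxx _) K0 aK.
by rewrite yK.
Qed.

Lemma linked_edge v (K : {set V}) u : linked G v K -> u \in K -> ~~ G v u ->
  exists p q, [/\ p \in K, q \in K, G p q, ~~ G v p & G v q].
Proof.
move=> lvK uK vu; pose D := [set p in K | ~~ G v p].
have [|||p [q [pD qK qD pq]]] := lvK D.
- by apply/subsetP => p; rewrite inE => /andP[].
- by apply/set0Pn; exists u; rewrite inE uK.
- by move=> p; rewrite inE => /andP[].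
exists p, q; move: pD qD; rewrite !inE qK /= negbK => /andP[pK vp] vq.
by split.
Qed.

(** Otherwise an edge [x y] leaves the set of those nonneighbours of [l] that share no neighbour
    with it in [K]; then [x], [y], a common neighbour [q] of [y] and [l], and finally [l] and [c]
    form an induced path. *)
Lemma linked_dist2 l c (K : {set V}) p : linked G l K -> anticomplete G c K ->
  G c l -> p \in K -> ~~ G l p -> exists2 q, q \in K & G p q && G l q.
Proof.
move=> llK cK cl pK lp.
have [/exists_inP//|far] := boolP [exists q in K, G p q && G l q].
pose D := [set p in K | ~~ G l p && ~~ [exists q in K, G p q && G l q]].
have [|||x [y [xD yK yD xy]]] := llK D.
- by apply/subsetP => q; rewrite inE => /andP[].
- by apply/set0Pn; exists p; rewrite inE pK lp.
- by move=> q; rewrite inE => /and3P[].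
move: xD yD; rewrite !inE yK => /and3P[xK lx].
rewrite negb_exists_in => /forall_inP xfar.
have ly : ~~ G l y by have := xfar y yK; rewrite xy.
rewrite ly /= negbK => /exists_inP[q qK /andP[yq lq]].
have xq : ~~ G x q by have := xfar q qK; rewrite lq andbT.
have [cx cy cq] := And3 (cK x xK) (cK y yK) (cK q qK).
by exfalso; apply: (@no_path5 _ _ fG x y q l c); adj_done.
Qed.

(** Take [v] in [K] with the most neighbours in [L]. If it misses [l], the vertex [q] from
    [linked_dist2] gains [l]; it loses no [l'], else the square [l l' v q] with the roof [c] is a
    house. *)
Lemma linked_common_nbr (K L : {set V}) c : K != set0 -> clique G L ->
  anticomplete G c K -> complete G c L -> {in L, forall l, linked G l K} ->
  exists2 v, v \in K & complete G v L.
Proof.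
move=> /set0Pn[v0 v0K] clL cK cL lL.
pose nL v := [set l in L | G v l].
case: (@arg_maxnP _ v0 [pred v in K] (fun v => #|nL v|)) => // v /= vK vmax.
exists v => // l lL'; apply/negPn/negP => vl.
have [|q qK /andP[vq lq]] := linked_dist2 (lL l lL') cK (cL l lL') vK.
  by rewrite adj_sym.
have /vmax : q \in K by [].
apply/negP; rewrite -ltnNge; apply: proper_card; apply/properP; split; last first.
  by exists l; rewrite !inE lL' //= adj_sym.
apply/subsetP => l'; rewrite !inE => /andP[l'L vl']; rewrite l'L /=.
apply/negPn/negP => ql'; have ll' : G l l'.
  by apply: clL => //; apply: contraNneq vl => ->.
have [cl cl' cv cq] := And4 (cL l lL') (cL l' l'L) (cK v vK) (cK q qK).
by apply: (@no_house _ _ fG l l' v q c); adj_done.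
Qed.

(** Otherwise a neighbour [q] shared by [k] and [b'] completes the path [k b a b'] to a house or a
    5-cycle, according to whether [b] sees [q]. *)
Lemma linked_nonadj_sub b b' a (K : {set V}) k : ~~ G b b' ->
  anticomplete G a K -> G a b -> G a b' -> linked G b' K ->
  k \in K -> G b k -> G b' k.
Proof.
move=> bb' aK ab ab' lb' kK bk; apply/negPn/negP => b'k.
have [q qK /andP[kq b'q]] := linked_dist2 lb' aK ab' kK b'k.
have [ak aq] := conj (aK k kK) (aK q qK); have [bq|bq] := boolP (G b q).
  by apply: (@no_house _ _ fG q b a b' k); adj_done.
by apply: (@no_cycle5 _ _ fG k b a b' q); adj_done.
Qed.

End Linked.

Record cut (V : finType) (G : sgraph V) (A C N T : {set V}) : Prop := Cut {
  cut_disjoint :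
    pairwise (fun X Y : {set V} => [disjoint X & Y]) [:: A; C; N; T];
  cut_cover : forall x, [|| x \in A, x \in C, x \in N | x \in T];
  cut_A : 1 < #|A|;
  cut_C : 1 < #|C|;
  cut_AC : anticomplete_set G A C;
  cut_TA : anticomplete_set G T A;
  cut_TC : anticomplete_set G T C;
  cut_T : stable G T;
  cut_NA : {in N, forall v, linked G v A};
  cut_NC : {in N, forall v, linked G v C}
}.

Lemma cut_sym (V : finType) (G : sgraph V) A C N T :
  cut G A C N T -> cut G C A N T.
Proof.
case=> dj cov A1 C1 AC TA TC sT NA NC; split => //.
  move: dj; rewrite /= !andbT disjoint_sym.
  by case/and3P=> [/and3P[-> -> ->] /andP[-> ->] ->].
  by move=> x; have := cov x; rewrite orbCA.
by move=> x xC y yA; rewrite adj_sym; apply: AC.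
Qed.

(** * Existence of a cut *)

Section ExistsCut.
Variables (V : finType) (G : sgraph V).

Let noiso (K : {set V}) : bool := [forall x in K, exists y in K, G x y].
Let sides (p : {set V} * {set V}) : bool :=
  [&& p.1 != set0, p.2 != set0, noiso p.1, noiso p.2
    & [forall x in p.1, forall y in p.2, ~~ G x y]].

Let sidesP (A C : {set V}) : reflect
  [/\ A != set0, C != set0, {in A, forall x, exists2 y, y \in A & G x y},
      {in C, forall x, exists2 y, y \in C & G x y} & anticomplete_set G A C]
  (sides (A, C)).
Proof.
have nP (K : {set V}) : reflect {in K, forall x, exists2 y, y \in K & G x y} (noiso K).
  apply: (iffP forall_inP) => h x xK; first exact/exists_inP/h.
  exact/exists_inP/h.
apply: (iffP and5P) => [[A0 C0 /nP nA /nP nC /forall_inP aAC]|[A0 C0 nA nC aAC]].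
  by split=> // x xA y yC; have /forall_inP/(_ y yC) := aAC x xA.
split=> //; try exact/nP.
by apply/forall_inP => x xA; apply/forall_inP => y yC; apply: aAC.
Qed.

Let sides_sym A C : sides (A, C) -> sides (C, A).
Proof.
move/sidesP=> [A0 C0 nA nC AC]; apply/sidesP; split=> // x xC y yA.
by rewrite adj_sym; apply: AC.
Qed.

Let big (A C : {set V}) := forall A' C' : {set V}, sides (A', C') -> #|A'| + #|C'| <= #|A| + #|C|.

Let noiso_card (K : {set V}) : K != set0 ->
  {in K, forall x, exists2 y, y \in K & G x y} -> 1 < #|K|.
Proof.
case/set0Pn=> x xK nK; have [y yK xy] := nK x xK; apply/card_gt1P.
by exists x, y; split=> //; apply: contraTneq xy => ->; rewrite adj_irr.
Qed.

Let extend A C v : sides (A, C) -> big A C -> v \notin A :|: C ->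
  [exists x in A, G v x] -> [exists x in C, G v x].
Proof.
move=> /sidesP[A0 C0 nA nC AC] bAC; rewrite inE => /norP[vA vC].
case/exists_inP=> a aA va.
have [//|] := boolP [exists x in C, G v x].
rewrite negb_exists_in => /forall_inP vnC; have /bAC : sides (v |: A, C).
  apply/sidesP; split=> //.
  - by apply/set0Pn; exists v; rewrite !inE eqxx.
  - move=> x /setU1P[->|xA]; first by exists a; rewrite // inE aA orbT.
    by have [y yA xy] := nA x xA; exists y; rewrite // inE yA orbT.
  - by move=> x /setU1P[->|xA] y yC; [apply: vnC | apply: AC].
by rewrite cardsU1 vA /= add1n addSn ltnn.
Qed.

(** A nonempty [D] with no edge to the rest of [C] or to [v] could be kept as one side, while [v]
    and all of [C] outside [D] join [A]: the total size would grow by one. *)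
Let big_linked A C v : sides (A, C) -> big A C -> v \notin A :|: C ->
  [exists x in A, G v x] -> linked G v C.
Proof.
move=> /sidesP[A0 C0 nA nC AC] bAC; rewrite inE => /norP[vA vC].
case/exists_inP=> a aA va D DC D0 vD.
have [/existsP[x /existsP[y /and4P[]]]|clD] := boolP
    [exists x, exists y, [&& x \in D, y \in C, y \notin D & G x y]].
  by exists x, y.
have DP x y : x \in D -> y \in C -> G x y -> y \in D.
  move=> xD yC xy; apply/negPn/negP => yD; case/negP: clD.
  by apply/existsP; exists x; apply/existsP; exists y; rewrite xD yC yD.
have /bAC : sides (v |: (A :|: (C :\: D)), D).
  apply/sidesP; split=> //.
  - by apply/set0Pn; exists v; rewrite !inE eqxx.
  - move=> x; rewrite !inE => /or3P[/eqP->|xA|/andP[xD xC]].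
    + by exists a; rewrite // !inE aA orbT.
    + by have [y yA xy] := nA x xA; exists y; rewrite // !inE yA orbT.
    + have [y yC xy] := nC x xC; exists y; rewrite // !inE yC andbT.
      rewrite [y \notin D](contra _ xD) ?orbT // => yD.
      by apply: (DP y); rewrite // adj_sym.
  - move=> x xD; have [y yC xy] := nC x (subsetP DC x xD).
    by exists y => //; apply: DP xy.
  - move=> x; rewrite !inE => /or3P[/eqP->|xA|/andP[xD xC]] y yD.
    + exact: vD.
    + by apply: AC => //; apply: (subsetP DC).
    + by apply/negP => xy; case/negP: xD; apply: (DP y); rewrite // adj_sym.
have dAC : [disjoint A & C :\: D].
  rewrite -setI_eq0; apply/eqP/setP => x; rewrite !inE.
  apply/negP => /and3P[xA _ xC]; have [y yA xy] := nA x xA.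
  by have := AC y yA x xC; rewrite adj_sym xy.
rewrite cardsU1 !inE (negPf vA) (negPf vC) andbF /= add1n cardsU.
move: dAC; rewrite -setI_eq0 => /eqP->; rewrite cards0 subn0 cardsD.
by rewrite (setIidPr DC) addSn -addnA subnK ?ltnn // subset_leq_card.
Qed.

Lemma exists_cut : two_edges G -> exists A C N T, cut G A C N T.
Proof.
case/existsP=> a /existsP[b /existsP[c /existsP[d]]].
case/and5P=> ab cd ac ad /andP[bc bd].
have pair x y : G x y ->
    [set x; y] != set0 /\
    {in [set x; y], forall u, exists2 w, w \in [set x; y] & G u w}.
  move=> xy; split; first by apply/set0Pn; exists x; rewrite !inE eqxx.
  move=> u; rewrite !inE => /orP[]/eqP->; [exists y | exists x];
    by rewrite ?inE ?eqxx ?orbT // adj_sym.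
have s0 : sides ([set a; b], [set c; d]).
  have [a0 na] := pair _ _ ab; have [c0 nc] := pair _ _ cd; apply/sidesP; split=> //.
  by move=> x /set2P[]-> y /set2P[]->.
case: (@arg_maxnP _ _ sides (fun p => #|p.1| + #|p.2|) s0) => -[A C] sAC bg.
have {bg} bAC : big A C by move=> A' C' /bg.
have bCA : big C A by move=> A' C' /bAC; rewrite (addnC #|C|).
have sCA := sides_sym sAC; move/sidesP: (sAC) => [A0 C0 nA nC AC].
(* Looking at [A] alone is enough: by [extend], a vertex outside the two sides has a neighbour in
   one exactly when it has one in the other. *)
pose N := [set v in ~: (A :|: C) | [exists x in A, G v x]].
pose T := [set v in ~: (A :|: C) | ~~ [exists x in A, G v x]].
have TA : anticomplete_set G T A.
  move=> t; rewrite inE => /andP[_]; rewrite negb_exists_in => /forall_inP tA x.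
  exact: tA.
have TC : anticomplete_set G T C.
  move=> t; rewrite inE in_setC => /andP[tAC ntA] x xC; apply/negP => tx.
  case/negP: ntA; apply: (extend sCA bCA); first by rewrite setUC.
  by apply/exists_inP; exists x.
exists A, C, N, T; split=> //.
- rewrite /= !andbT -!setI_eq0; apply/and3P; split; first (apply/and3P; split);
    last by apply/eqP/setP => x; rewrite !inE; case: [exists _ in _, _]; rewrite !andbF.
  + apply/eqP/setP => x; rewrite !inE; apply/negP => /andP[xA xC].
    have [y yA xy] := nA x xA.
    by have := AC y yA x xC; rewrite adj_sym xy.
  + by apply/eqP/setP => x; rewrite !inE; case: (x \in A).
  + by apply/eqP/setP => x; rewrite !inE; case: (x \in A).
  + by apply/andP; split; apply/eqP/setP => x; rewrite !inE;
      case: (x \in C); rewrite ?orbT.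
- by move=> x; rewrite !inE; case: (x \in A); case: (x \in C) => //=;
    case: [exists _ in _, _].
- exact: noiso_card.
- exact: noiso_card.
- move=> s t sT tT; apply/negP => st.
  have notin u : u \in T -> u \notin A /\ u \notin C.
    by rewrite !inE => /andP[/norP].
  have [sA sC] := notin s sT; have [tA tC] := notin t tT.
  (* Two adjacent vertices of [T] could both be added to [C]. *)
  have /bAC : sides (A, s |: (t |: C)).
    apply/sidesP; split=> //.
    + by apply/set0Pn; exists s; rewrite !inE eqxx.
    + move=> x; rewrite !inE => /or3P[/eqP->|/eqP->|xC].
      * by exists t; rewrite // !inE eqxx orbT.
      * by exists s; rewrite 1?adj_sym // !inE eqxx.
      * by have [y yC xy] := nC x xC; exists y; rewrite // !inE yC !orbT.
    + move=> x xA y; rewrite !inE => /or3P[/eqP->|/eqP->|yC]; last exact: AC.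
      * by rewrite adj_sym; apply: TA.
      * by rewrite adj_sym; apply: TA.
  rewrite !cardsU1 !inE (negPf sC) (negPf tC) orbF.
  have -> : s != t by apply: contraTneq st => ->; rewrite adj_irr.
  by rewrite /= leq_add2l !add1n ltnNge leqnSn.
- move=> v; rewrite inE in_setC => /andP[vAC vA].
  apply: (big_linked sCA bCA); first by rewrite setUC.
  exact: (extend sAC bAC).
- move=> v; rewrite inE in_setC => /andP[vAC vA].
  exact: (big_linked sAC bAC).
Qed.

End ExistsCut.

Lemma card_gt1_neq0 (T : finType) (K : {set T}) : 1 < #|K| -> K != set0.
Proof. by move/ltnW; rewrite card_gt0. Qed.

Definition completeb (V : finType) (G : sgraph V) v (K : {set V}) : bool :=
  [forall x in K, G v x].

Lemma completebP (V : finType) (G : sgraph V) v K :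
  reflect (complete G v K) (completeb G v K).
Proof. by apply: (iffP forall_inP). Qed.

Lemma completebPn (V : finType) (G : sgraph V) v (K : {set V}) :
  reflect (exists2 x, x \in K & ~~ G v x) (~~ completeb G v K).
Proof.
by apply: (iffP idP) => [|[x xK vx]]; rewrite negb_forall_in;
  [move/exists_inP | apply/exists_inP; exists x].
Qed.

(** * How [N] attaches to the two sides *)

Section CutTheory.
Variables (V : finType) (G : sgraph V) (A C N T : {set V}).
Hypotheses (fG : P5_coP5_C5_free G) (ct : cut G A C N T).

Lemma cut_notin x :
  [/\ x \in A -> [/\ x \notin C, x \notin N & x \notin T],
      x \in C -> [/\ x \notin A, x \notin N & x \notin T],
      x \in N -> [/\ x \notin A, x \notin C & x \notin T]
    & x \in T -> [/\ x \notin A, x \notin C & x \notin N]].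
Proof.
have := cut_disjoint ct; rewrite /= !andbT.
case/and3P=> /and3P[AC AN AT] /andP[CN CT] NT.
split=> xX.
- by rewrite (disjointFr AC) ?(disjointFr AN) ?(disjointFr AT).
- by rewrite (disjointFl AC) ?(disjointFr CN) ?(disjointFr CT).
- by rewrite (disjointFl AN) ?(disjointFl CN) ?(disjointFr NT).
- by rewrite (disjointFl AT) ?(disjointFl CT) ?(disjointFl NT).
Qed.

(** A vertex of [N] mixed on both sides would be the middle of an induced path, continued by an edge
    of each side. *)
Lemma cut_complete v : v \in N -> ~~ completeb G v A -> complete G v C.
Proof.
move=> vN /completebPn[a aA va] c cC; apply/negPn/negP => vc.
have [p [q [pA qA pq vp vq]]] := linked_edge (cut_NA ct vN) aA va.
have [r [s [rC sC rs vr vs]]] := linked_edge (cut_NC ct vN) cC vc.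
have [ps pr qs qr] := And4 (cut_AC ct pA sC) (cut_AC ct pA rC)
  (cut_AC ct qA sC) (cut_AC ct qA rC).
by apply: (@no_path5 _ _ fG p q v s r); adj_done.
Qed.

(** [B] collects the vertices of [N] complete to [A]; the others are complete to [C]. The common
    neighbours come from [linked_common_nbr], with any vertex of the opposite side as outside
    vertex, and the mixing condition is void because [B] is a clique. *)
Lemma cut_clique_divide : clique G N ->
  exists B L, split_divide G A B C L T.
Proof.
move=> clN; pose B := [set v in N | completeb G v A].
pose L := [set v in N | ~~ completeb G v A].
have [/card_gt1_neq0 A0 /card_gt1_neq0 C0] := conj (cut_A ct) (cut_C ct).
have BN v : v \in B -> v \in N by rewrite inE => /andP[].
have LN v : v \in L -> v \in N by rewrite inE => /andP[].
have BA v : v \in B -> complete G v A by rewrite inE => /andP[_ /completebP].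
have LC v : v \in L -> complete G v C by rewrite inE => /andP[]; apply: cut_complete.
have BL v : v \in B -> v \notin L.
  by rewrite !inE negb_and negbK => /andP[_ ->]; rewrite orbT.
exists B, L; split.
- have := cut_disjoint ct; rewrite /= !andbT.
  case/and3P=> /and3P[-> AN ->] /andP[CN ->] NT.
  have [sB sL] : B \subset N /\ L \subset N.
    by split; apply/subsetP => x; rewrite inE => /andP[].
  rewrite (disjointWr sB AN) (disjointWr sL AN) (disjointWl sB NT).
  rewrite (disjointWl sL NT) (disjointWr sL CN) disjoint_sym (disjointWr sB CN).
  by rewrite /= !andbT; rewrite disjoint_subset; apply/subsetP => x /BL.
- move=> x; have := cut_cover ct x; rewrite !inE.
  by case: (x \in A); case: (x \in C); case: (x \in N); case: (x \in T);
    case: completeb.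
- exact: cut_A ct.
- exact: cut_C ct.
- by move=> x y /LN xN /LN yN; apply: clN.
- exact: cut_T ct.
- by move=> x xA y /BA; rewrite adj_sym; apply.
- exact: cut_AC ct.
- by move=> x xA y yT; rewrite adj_sym; apply: (cut_TA ct).
- have /set0Pn[c cC] := C0.
  apply: (@linked_common_nbr _ _ fG A L c) => //.
  + by move=> x y /LN xN /LN yN; apply: clN.
  + by move=> x xA; rewrite adj_sym; apply: (cut_AC ct).
  + by move=> x xL; rewrite adj_sym; apply: LC.
  + by move=> x /LN; apply: (cut_NA ct).
- exact: cut_TC ct.
- move=> x xL y; rewrite inE => /orP[yB|]; last exact: LC.
  apply: clN (LN _ xL) (BN _ yB) _.
  by apply: contraTneq xL => ->; apply: BL.
- have /set0Pn[a aA] := A0.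
  apply: (@linked_common_nbr _ _ fG C B a) => //.
  + by move=> x y /BN xN /BN yN; apply: clN.
  + exact: (cut_AC ct).
  + by move=> x xB; rewrite adj_sym; apply: BA.
  + by move=> x /BN; apply: (cut_NC ct).
- by move=> v _ x y /BN xN /BN yN nxy; rewrite clN.
Qed.

Lemma cut_nonadj_sides b b' : b \in N -> b' \in N -> b != b' -> ~~ G b b' ->
  complete G b A /\ complete G b' A \/ complete G b C /\ complete G b' C.
Proof.
have /card_gt1_neq0 C0 := cut_C ct.
have key u u' : u \in N -> u' \in N -> ~~ G u u' -> complete G u C ->
    ~~ completeb G u A -> complete G u' A -> False.
  move=> uN u'N uu' uC /completebPn[a aA ua] u'A.
  have [p [q [pA qA pq up uq]]] := linked_edge (cut_NA ct uN) aA ua.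
  have [c cC u'c] := linked_nbr C0 (cut_NC ct u'N).
  have [pc qc uc] := And3 (cut_AC ct pA cC) (cut_AC ct qA cC) (uC c cC).
  have [u'p u'q] := conj (u'A p pA) (u'A q qA).
  by apply: (@no_house _ _ fG q u' c u p); adj_done.
move=> bN b'N nbb' bb'; have b'b : ~~ G b' b by rewrite adj_sym.
have [bA|bA] := boolP (completeb G b A).
  have [b'A|b'A] := boolP (completeb G b' A).
    by left; split; apply/completebP.
  by case: (key b' b) => //; [apply: cut_complete | apply/completebP].
have bC := cut_complete bN bA; have [b'A|b'A] := boolP (completeb G b' A).
  by case: (key b b') => //; apply/completebP.
by right; split=> //; apply: cut_complete.
Qed.

(** Both vertices are complete to one side, and a vertex of that side serves as [a] in
    [linked_nonadj_sub] for the other side. *)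
Lemma cut_nonadj_twins b b' k : b \in N -> b' \in N -> b != b' -> ~~ G b b' ->
  k \in A :|: C -> G k b -> G k b'.
Proof.
move=> bN b'N nbb' bb'; rewrite inE !(adj_sym G k).
have /card_gt1_neq0/set0Pn[a aA] := cut_A ct.
have /card_gt1_neq0/set0Pn[c cC] := cut_C ct.
have [[bA b'A]|[bC b'C]] := cut_nonadj_sides bN b'N nbb' bb'.
  case/orP=> [kA _|kC]; first exact: b'A.
  apply: (@linked_nonadj_sub _ _ fG b b' a C) => //; last exact: (cut_NC ct).
  - exact: (cut_AC ct).
  - by rewrite adj_sym; apply: bA.
  - by rewrite adj_sym; apply: b'A.
case/orP=> [kA|kC _]; last exact: b'C.
apply: (@linked_nonadj_sub _ _ fG b b' c A) => //; last exact: (cut_NA ct).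
- by move=> x xA; rewrite adj_sym; apply: (cut_AC ct).
- by rewrite adj_sym; apply: bC.
- by rewrite adj_sym; apply: b'C.
Qed.

Lemma cut_nbr_T t x : t \in T -> G t x -> x \in N.
Proof.
move=> tT tx; have := cut_cover ct x.
case: (boolP (x \in A)) => [/(cut_TA ct tT)|_]; first by rewrite tx.
case: (boolP (x \in C)) => [/(cut_TC ct tT)|_]; first by rewrite tx.
case: (boolP (x \in T)) => [/(cut_T ct tT)|_]; first by rewrite tx.
by rewrite orbF.
Qed.

End CutTheory.

(** * Anticomponents of the cut *)

Section Anticomponents.
Variables (V : finType) (G : sgraph V) (N T : {set V}).
Hypothesis (fG : P5_coP5_C5_free G).

Definition nonadj_in : rel V :=
  fun x y => [&& x \in N, y \in N, x != y & ~~ G x y].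

(** For [x] in [N] this is the anticomponent of [N] around [x], computed on [V] itself rather than
    on the subtype used by [anticomponent]. *)
Definition anticomp x : {set V} := [set y | connect nonadj_in x y].

Lemma nonadj_in_sym : symmetric nonadj_in.
Proof.
by move=> x y; rewrite /nonadj_in eq_sym adj_sym andbCA.
Qed.

Lemma connect_nonadj_sym : connect_sym nonadj_in.
Proof. exact/sym_connect_sym/nonadj_in_sym. Qed.

Lemma anticomp_sub x y : x \in N -> y \in anticomp x -> y \in N.
Proof.
move=> xN; rewrite inE => /(@closed_connect _ nonadj_in (mem N)) => <- //.
by move=> u v /and4P[uN vN _ _]; rewrite uN vN.
Qed.

Lemma anticomp_refl x : x \in anticomp x.
Proof. by rewrite inE connect0. Qed.

Lemma anticomp_adj x y z : x \in N -> y \in anticomp x -> z \in N ->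
  z \notin anticomp x -> G y z.
Proof.
move=> xN yX zN zX; have yN := anticomp_sub xN yX.
apply/negPn/negP => yz; case/negP: (zX); move: (yX); rewrite !inE => xy.
apply: connect_trans xy (connect1 _); rewrite /nonadj_in yN zN yz andbT /=.
by apply: contraNneq zX => <-.
Qed.

Lemma anticomp_break (p : pred V) x u v : u \in anticomp x ->
  v \in anticomp x -> p u -> ~~ p v ->
  exists y z, [/\ y \in anticomp x, z \in anticomp x, nonadj_in y z, p y & ~~ p z].
Proof.
rewrite !inE => xu xv pu pv.
have : connect nonadj_in u v.
  by apply: connect_trans xv; rewrite connect_nonadj_sym.
case/connectP=> s; elim: s u xu pu => [|w s IHs] u xu pu /= => [_ eqv|].
  by rewrite eqv pu in pv.
case/andP=> uw ws eqv; have xw := connect_trans xu (connect1 uw).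
have [pw|pw] := boolP (p w); first exact: (IHs w xw pw ws eqv).
by exists u, w; rewrite !inE.
Qed.

Lemma nonadj_inW y z : nonadj_in y z -> ~~ G y z.
Proof. by case/and4P. Qed.

Definition full x : {set V} := [set t in T | completeb G t (anticomp x)].

(* Anticomponents X of N on which many vertices of T are complete come first:
   a vertex t of T that is mixed on X and has a neighbour in another nontrivial
   anticomponent Y is complete to Y, and so is every vertex of T that is
   complete to X. *)
Lemma full_max x q q' t : stable G T -> x \in N -> t \in T ->
  (forall r r', nonadj_in r r' -> #|full r| <= #|full x|) ->
  (exists2 y, y \in anticomp x & G t y) ->
  (exists2 y, y \in anticomp x & ~~ G t y) ->
  q \notin anticomp x -> nonadj_in q q' -> G t q -> False.
Proof.
move=> stT xN tT maxx [u uX tu] [v vX tv] qX qq' tq.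
have qN : q \in N by case/and4P: qq'.
have YX y : y \in anticomp q -> y \notin anticomp x.
  rewrite !inE connect_nonadj_sym => yq; apply: contra qX; rewrite inE.
  by move/connect_trans; apply.
have XY y r : y \in anticomp x -> r \in anticomp q -> G y r.
  move=> yX rY; apply: anticomp_adj yX _ _ => //; last exact: YX.
  exact: anticomp_sub rY.
have [y [z [yX zX /nonadj_inW yz ty tz]]] :=
  @anticomp_break (fun w => G t w) x u v uX vX tu tv.
have tY : complete G t (anticomp q).
  move=> w wY; apply/negPn/negP => tw.
  have [r [r' [rY r'Y /nonadj_inW rr' tr tr']]] :=
    @anticomp_break (fun w => G t w) q q w (anticomp_refl q) wY tq tw.
  have [yr zr yr' zr'] := And4 (XY y r yX rY) (XY z r zX rY) (XY y r' yX r'Y)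
    (XY z r' zX r'Y).
  by apply: (@no_house _ _ fG y r z r' t); adj_done.
have : full x \proper full q.
  apply/properP; split; last first.
    exists t; first by rewrite inE tT; apply/completebP.
    rewrite inE tT; apply/negP => /completebP/(_ z zX).
    by rewrite (negPf tz).
  apply/subsetP => s; rewrite !inE => /andP[sT /completebP sX].
  rewrite sT; apply/completebP => r rY; apply/negPn/negP => sr.
  have [sy sz tr] := And3 (sX y yX) (sX z zX) (tY r rY).
  have [yr zr ts] := And3 (XY y r yX rY) (XY z r zX rY) (stT _ _ tT sT).
  by apply: (@no_house _ _ fG y r z s t); adj_done.
by move/proper_card; rewrite ltnNge (maxx q q').
Qed.

End Anticomponents.

(** * Dividing the complement along an anticomponent of [N] *)

Section ComplementDivide.
Variables (V : finType) (G : sgraph V) (A C N T : {set V}) (x x' : V).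
Hypotheses (fG : P5_coP5_C5_free G) (ct : cut G A C N T).
Hypothesis xx' : nonadj_in G N x x'.
Hypothesis maxx : forall r r', nonadj_in G N r r' ->
  #|full G N T r| <= #|full G N T x|.

Let X := anticomp G N x.
Let xN : x \in N. Proof. by case/and4P: xx'. Qed.
Let xX : x \in X. Proof. exact: anticomp_refl. Qed.
Let XN y : y \in X -> y \in N. Proof. exact: anticomp_sub. Qed.

Let X1 : 1 < #|X|.
Proof.
apply/card_gt1P; exists x, x'; split=> //; last by case/and4P: xx'.
by rewrite inE connect1.
Qed.

Let X_twins k y z : k \in A :|: C -> y \in X -> z \in X -> G k y = G k z.
Proof.
move=> kAC; rewrite !inE.
have cl : closed (nonadj_in G N) (G k).
  move=> u v /and4P[uN vN nuv uv]; rewrite -!topredE /=.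
  apply/idP/idP; first exact: (cut_nonadj_twins fG ct).
  by apply: (cut_nonadj_twins fG ct) => //; rewrite 1?eq_sym 1?adj_sym.
move=> /(closed_connect cl); rewrite -!topredE /= => <-.
by move=> /(closed_connect cl); rewrite -!topredE /= => <-.
Qed.

Let N_complete v : v \in N -> v \notin X -> complete G v X.
Proof. by move=> vN vX y yX; rewrite adj_sym; apply: anticomp_adj yX vN vX. Qed.

Let TX := [set t in T | [exists y in X, G t y] && ~~ completeb G t X].

(** Vertices of [A] and [C] do not distinguish nonadjacent vertices of [N], and those of [N] outside
    [X] are complete to [X]; only [T] remains. *)
Let mixed_TX v y z : v \notin X -> y \in X -> z \in X -> G v y -> ~~ G v z ->
  v \in TX.
Proof.
move=> vX yX zX vy vz; rewrite inE; apply/and3P; split.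
- case/or4P: (cut_cover ct v) => // vS.
  + by case/negP: vz; rewrite -(@X_twins v y) // inE vS.
  + by case/negP: vz; rewrite -(@X_twins v y) // inE vS orbT.
  + by case/negP: vz; apply: N_complete.
- by apply/exists_inP; exists y.
- by apply/completebPn; exists z.
Qed.

Lemma anticomp_homogeneous : TX = set0 -> homogeneous G X.
Proof.
move=> TX0; split=> //.
  have /card_gt1_neq0/set0Pn[a aA] := cut_A ct.
  rewrite -(cardsC X) -[ltnLHS]addn0 ltn_add2l card_gt0; apply/set0Pn.
  exists a; rewrite inE; apply/negP => /XN; apply/negP.
  by have [/(_ aA)[]] := cut_notin ct a.
move=> v y z vX yX zX; apply/idP/idP => vG; apply/negPn/negP => nvG.
  by have := mixed_TX vX yX zX vG nvG; rewrite TX0 inE.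
by have := mixed_TX vX zX yX vG nvG; rewrite TX0 inE.
Qed.

Let anti v := [forall y in X, ~~ G v y].
(** In the complement, [X], [B'], [C'], [TX], [T'] play the roles of [A], [B], [C], [L], [T]. A
    vertex outside [X] is sorted by being anticomplete to, mixed on or complete to [X], and in the
    last case by whether it has a neighbour in [TX]. *)
Let B' := [set v in ~: X | anti v].
Let T' := [set v | completeb G v X && [exists t in TX, G v t]].
Let C' := [set v | completeb G v X && ~~ [exists t in TX, G v t]].

Let TXP t : t \in TX ->
  exists y z, [/\ t \in T, y \in X /\ z \in X, G t y, ~~ G t z & ~~ G y z].
Proof.
rewrite inE => /and3P[tT /exists_inP[u uX tu] /completebPn[v vX tv]].
have [y [z [yX zX /nonadj_inW yz ty tz]]] :=
  @anticomp_break _ G N (fun w => G t w) x u v uX vX tu tv.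
by exists y, z.
Qed.

Lemma anticomp_divide : TX != set0 -> complete G x C ->
  split_divide (compl G) X B' C' TX T'.
Proof.
move=> /set0Pn[s0 s0TX] xC.
have /card_gt1_neq0/set0Pn[c0 c0C] := cut_C ct.
have XC y c : y \in X -> c \in C -> G c y.
  move=> yX cC; rewrite (@X_twins c y x) // ?inE ?cC ?orbT //.
  by rewrite adj_sym; apply: xC.
have TXT t : t \in TX -> t \in T by rewrite inE => /andP[].
have TX_X t : t \in TX -> t \notin X.
  move=> /TXT tT; apply/negP => /XN; apply/negP.
  by have [_ _ _ /(_ tT)[]] := cut_notin ct t.
have B'P v : v \in B' ->
    [/\ v \notin X, v \notin C, v \notin N & forall y, y \in X -> ~~ G v y].
  rewrite inE in_setC => /andP[vX /forall_inP vanti]; split=> //.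
  - by apply/negP => vC; have := vanti x xX; rewrite XC.
  - by apply/negP => vN; have := vanti x xX; rewrite N_complete.
have C'P v : v \in C' ->
    [/\ v \notin X, complete G v X & forall t, t \in TX -> ~~ G v t].
  rewrite inE negb_exists_in => /andP[/completebP vX /forall_inP vTX]; split=> //.
  by apply/negP => /vX; rewrite adj_irr.
have T'P v : v \in T' ->
    [/\ v \notin X, complete G v X & exists2 t, t \in TX & G v t].
  rewrite inE => /andP[/completebP vX /exists_inP vTX]; split=> //.
  by apply/negP => /vX; rewrite adj_irr.
(* The choice of [x] enters here: a vertex of [T'] with a nonneighbour in [N] would contradict
   [full_max]. Hence [T'] is a clique of [G]. *)
have T'N v : v \in T' -> v \in N /\ forall u, u \in N -> u != v -> G v u.
  case/T'P=> vX _ [t tTX vt]; have tT := TXT t tTX.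
  have vN : v \in N by apply: (cut_nbr_T ct tT); rewrite adj_sym.
  split=> // u uN nuv; apply/negPn/negP => vu.
  have [y [z [_ [yX zX] ty tz _]]] := TXP tTX.
  apply: (@full_max _ G N T fG x v u t (cut_T ct) xN tT maxx _ _ vX).
  - by exists y.
  - by exists z.
  - by rewrite /nonadj_in vN uN vu eq_sym nuv.
  - by rewrite adj_sym.
(* Otherwise [y q z v] is a square with the roof [t] over [y q]. *)
have T'C' q v : q \in T' -> v \in C' -> G q v.
  move=> /T'P[_ qX [t tTX qt]] /C'P[_ vX vTX]; apply/negPn/negP => qv.
  have [y [z [_ [yX zX] ty tz yz]]] := TXP tTX.
  have [qy qz vy vz] := And4 (qX y yX) (qX z zX) (vX y yX) (vX z zX).
  have vt := vTX t tTX.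
  by apply: (@no_house _ _ fG y q z v t); adj_done.
have co u v : u != v -> ~~ G u v -> compl G u v by rewrite /= /compl_rel => -> ->.
have nco u v : (u != v -> G u v) -> ~~ compl G u v.
  by rewrite /= /compl_rel negb_and negbK; case: eqVneq => //= _ ->.
have neqX u v : u \in X -> v \notin X -> u != v by move=> uX; apply: contraNneq => <-.
have TXB t b : t \in TX -> b \in B' -> t != b /\ ~~ G t b.
  move=> tTX /B'P[bX bC bN banti]; have [y [z [tT [yX zX] ty _ _]]] := TXP tTX.
  split; first by apply: contraTneq ty => ->; apply: banti.
  by apply: contra bN; apply: (cut_nbr_T ct).
have TXC t v : t \in TX -> v \in C' -> t != v /\ ~~ G t v.
  move=> tTX /C'P[vX cv vTX]; have [y [z [tT [yX zX] _ tz _]]] := TXP tTX.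
  split; first by apply: contraNneq tz => ->; apply: cv.
  by rewrite adj_sym; apply: vTX.
have CC' c : c \in C -> c \in C'.
  move=> cC; rewrite inE negb_exists_in; apply/andP; split.
    by apply/completebP => y yX; apply: XC.
  by apply/forall_inP => t /TXT tT; rewrite adj_sym; apply: (cut_TC ct).
(* [B'] lies within [A] and [T], and a vertex of [T] has all its neighbours in [N]. *)
have B'A b b' : b \in B' -> b' \in B' -> G b b' -> b \in A.
  move=> /B'P[_ bC bN _] /B'P[_ _ b'N _] bb'; have := cut_cover ct b.
  rewrite (negPf bC) (negPf bN) /= => /orP[//|bT].
  by rewrite (cut_nbr_T ct bT bb') in b'N.
split.
- rewrite /= !andbT -!setI_eq0.
  have dj (Y Z : {set V}) : (forall v, v \in Y -> v \notin Z) -> Y :&: Z == set0.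
    move=> YZ; apply/eqP/setP => v; rewrite in_setI in_set0; apply/negP.
    by case/andP=> /YZ/negP.
  have C'X v : v \in X -> v \notin C' by move=> vX; apply/negP => /C'P[]; rewrite vX.
  have T'X v : v \in X -> v \notin T' by move=> vX; apply/negP => /T'P[]; rewrite vX.
  have B'X v : v \in X -> v \notin B' by move=> vX; apply/negP => /B'P[]; rewrite vX.
  have TX'X v : v \in X -> v \notin TX by move=> vX; apply/negP => /TX_X; rewrite vX.
  have B'C v : v \in B' -> v \notin C'.
    move=> /B'P[_ _ _ /(_ x xX) vx]; apply/negP => /C'P[_ /(_ x xX)].
    by rewrite (negPf vx).
  have B'TX v : v \in B' -> v \notin TX.
    by move=> vB; apply/negP => vTX; have [] := TXB v v vTX vB; rewrite eqxx.
  have B'T v : v \in B' -> v \notin T'.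
    move=> /B'P[_ _ _ /(_ x xX) vx]; apply/negP => /T'P[_ /(_ x xX)].
    by rewrite (negPf vx).
  have C'TX v : v \in C' -> v \notin TX.
    by move=> vC; apply/negP => vTX; have [] := TXC v v vTX vC; rewrite eqxx.
  have C'T v : v \in C' -> v \notin T'.
    move=> /C'P[_ _ vTX]; apply/negP => /T'P[_ _ [t tTX]].
    by rewrite (negPf (vTX t tTX)).
  have TXT' v : v \in TX -> v \notin T'.
    move=> /TXT vT; apply/negP => /T'N[vN _].
    by have [_ _ /(_ vN)[_ _]] := cut_notin ct v; rewrite vT.
  by rewrite !dj.
- move=> v; have [vX|vX] := boolP (v \in X); first by rewrite !in_setU vX.
  have [vTX|vTX] := boolP (v \in TX); first by rewrite !in_setU vTX !orbT.
  have [va|] := boolP (anti v).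
    by rewrite !in_setU [v \in B']inE in_setC vX va !orbT.
  rewrite negb_forall_in => /exists_inP[y yX]; rewrite negbK => vy.
  have vc : completeb G v X.
    apply/completebP => z zX; apply/negPn/negP => vz.
    by case/negP: vTX; apply: (mixed_TX vX yX zX).
  rewrite !in_setU [v \in C']inE [v \in T']inE vc.
  by case: [exists _ in _, _]; rewrite /= ?orbT.
- exact: X1.
- apply: leq_trans (cut_C ct) (subset_leq_card _).
  by apply/subsetP => c; apply: CC'.
- move=> s t /TXT sT /TXT tT nst; apply: co => //; exact: (cut_T ct).
- move=> u v /T'N[uN uc] /T'N[vN _]; apply: nco => nuv.
  by apply: uc; rewrite // eq_sym.
- move=> y yX b /B'P[bX _ _ banti]; apply: co; first exact: neqX.
  by rewrite adj_sym; apply: banti.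
- by move=> y yX v /C'P[_ cv _]; apply: nco => _; rewrite adj_sym; apply: cv.
- by move=> y yX v /T'P[_ cv _]; apply: nco => _; rewrite adj_sym; apply: cv.
- apply: (@linked_common_nbr _ (compl G) (free_compl fG) X TX c0).
  + exact: card_gt1_neq0 X1.
  + move=> s t /TXT sT /TXT tT nst; apply: co => //; exact: (cut_T ct).
  + by move=> y yX; apply: nco => _; apply: XC.
  + move=> t tTX; have [ntc tc] := TXC t c0 tTX (CC' c0 c0C).
    by apply: co; [rewrite eq_sym | rewrite adj_sym].
  (* In [G], [t] is complete to [D], so [D] misses [z]; as [X] is connected in the complement, some
     edge of the complement leaves [D] within [X]. *)
  + move=> t tTX D DX /set0Pn[d dD] tD.
    have [y [z [_ [yX zX] _ tz _]]] := TXP tTX.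
    have zD : z \notin D.
      apply/negP => zD; case/negP: (tD z zD); apply: co => //.
      by rewrite eq_sym; apply: neqX zX (TX_X t tTX).
    have [u [v [uX vX /and4P[_ _ nuv uv] uD vD]]] := @anticomp_break _ G N
      (mem D) x d z (subsetP DX d dD) zX dD zD.
    by exists u, v; split=> //; apply: co.
- by move=> q qT v vC; apply: nco => _; apply: T'C'.
- move=> t tTX v; rewrite in_setU => /orP[vB|vC].
    by have [] := TXB t v tTX vB; apply: co.
  by have [] := TXC t v tTX vC; apply: co.
- exists c0; first exact: CC'.
  move=> b bB; have [bX bC bN banti] := B'P b bB; apply: co.
    by apply: contraNneq bC => <-.
  have := cut_cover ct b; rewrite (negPf bC) (negPf bN) /= adj_sym.
  by case/orP=> bS; [apply: (cut_AC ct) | apply: (cut_TC ct)].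
- move=> v vC' b b' bB b'B nbb'; rewrite /= /compl_rel nbb' /= negbK => bb'.
  have neq d : d \in B' -> v != d.
    case/B'P=> _ _ _ /(_ x xX) dx; case/C'P: vC' => _ /(_ x xX) vx _.
    by apply: contraTneq vx => ->.
  rewrite !neq //=; congr (~~ _).
  (* An edge [d d'] of [B'] distinguished by [v] starts the induced path [d' d v], prolonged into
     [X] and then to [c0] if [v] is in [A], or to [s0] if [v] is in [N]. *)
  have key d d' : d \in B' -> d' \in B' -> G d d' -> G v d -> G v d'.
    move=> dB d'B dd' vd; apply/negPn/negP => vd'.
    have d'd : G d' d by rewrite adj_sym.
    have [dA d'A] := conj (B'A _ _ dB d'B dd') (B'A _ _ d'B dB d'd).
    have [_ _ _ dX] := B'P d dB; have [_ _ _ d'X] := B'P d' d'B.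
    have [_ vX vTX] := C'P v vC'; case/or4P: (cut_cover ct v) => vS.
    - have [dx d'x vx] := And3 (dX x xX) (d'X x xX) (vX x xX).
      have [dc d'c vc xc] := And4 (cut_AC ct dA c0C) (cut_AC ct d'A c0C)
        (cut_AC ct vS c0C) (xC c0 c0C).
      by apply: (@no_path5 _ _ fG d' d v x c0); adj_done.
    - by have := cut_AC ct dA vS; rewrite adj_sym vd.
    - have [y [z [sT [yX _] sy _ _]]] := TXP s0TX.
      have [dy d'y vy] := And3 (dX y yX) (d'X y yX) (vX y yX).
      have [ds d's vs] := And3 (cut_TA ct sT dA) (cut_TA ct sT d'A) (vTX s0 s0TX).
      by apply: (@no_path5 _ _ fG d' d v y s0); adj_done.
    - by have := cut_TA ct vS dA; rewrite vd.
  by apply/idP/idP; apply: key; rewrite // adj_sym.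
Qed.

End ComplementDivide.

(** * The decomposition *)

Lemma two_edges_decomposition (V : finType) (G : sgraph V) :
  P5_coP5_C5_free G -> two_edges G ->
  [\/ exists X, homogeneous G X,
      from_split_unification P5_coP5_C5_free G
    | from_split_unification P5_coP5_C5_free (compl G)].
Proof.
move=> fG /exists_cut[A [C [N [T ct]]]].
pose nontriv x := [exists y, nonadj_in G N x y].
have [/existsP[x0 nx0]|clN] := boolP [exists x, nontriv x]; last first.
  have [|B [L sd]] := @cut_clique_divide _ _ _ _ _ _ fG ct.
    move=> x y xN yN nxy; apply/negPn/negP => xy; case/negP: clN.
    apply/existsP; exists x; apply/existsP; exists y.
    by rewrite /nonadj_in xN yN nxy.
  by constructor 2; apply: split_divide_unification sd.
case: (@arg_maxnP _ x0 nontriv (fun x => #|full G N T x|) nx0) => x.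
case/existsP=> x' xx' maxx.
have {}maxx r r' : nonadj_in G N r r' -> #|full G N T r| <= #|full G N T x|.
  by move=> rr'; apply: maxx; apply/existsP; exists r'.
have xN : x \in N by case/and4P: xx'.
have [TX0|TX0] := eqVneq [set t in T |
    [exists y in anticomp G N x, G t y] && ~~ completeb G t (anticomp G N x)] set0.
  by constructor 1; exists (anticomp G N x); apply: (anticomp_homogeneous fG ct xx').
constructor 3; apply: split_divide_unification; first exact: free_compl.
  (* By [cut_complete], [x] is complete to one of the two sides; [cut_sym] lets that side take the
     role of [C]. *)
  have [xA|xA] := boolP (completeb G x A).
    by apply: (anticomp_divide fG (cut_sym ct) xx' maxx TX0); apply/completebP.
  apply: (anticomp_divide fG ct xx' maxx TX0).
  exact: cut_complete fG ct _ xN xA.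
Qed.

Theorem theorem5p3 (V : finType) (G : sgraph V) :
  P5_coP5_C5_free G <->
  [\/ split_graph G,
      from_substitution P5_coP5_C5_free G
    | from_split_unification P5_coP5_C5_free G \/
      from_split_unification P5_coP5_C5_free (compl G)].
Proof.
split=> [fG|[||[|]]]; first 1 last.
- exact: split_free.
- exact: from_substitution_free.
- exact: from_split_unification_free.
- by move/from_split_unification_free/free_of_compl.
have [G2|no2] := boolP (two_edges G).
  have [[X hX]|uG|uG] := two_edges_decomposition fG G2.
  - by constructor 2; apply: homogeneous_substitution hX.
  - by constructor 3; left.
  - by constructor 3; right.
have [G4|no4] := boolP (two_edges (compl G)); last first.
  by constructor 1; apply: foldes_hammer.
(* The complement is decomposed instead: its homogeneous sets are those of [G], and the two
   unification outcomes trade places. *)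
have [[X hX]|uG|uG] := two_edges_decomposition (free_compl fG) G4.
- by constructor 2; apply: homogeneous_substitution (homogeneous_compl hX).
- by constructor 3; right.
- constructor 3; left; apply: from_split_unification_ext uG.
  exact: compl_involutive.
Qed.
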